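(* Unless the Exponential Time Hypothesis (ETH) is false, there is no polynomial-time approximation algorithm for the Max-MIM problem with approximation ratio $n^{1/\operatorname{poly}\log\log n}$, where $n$ is the number of nodes of the input graph.
   Context: Independent Multi-Cascade (IMC) model. A social network is a finite directed graph $G=(V,E)$ with $n=|V|$, $m=|E|$; each edge $(u,v)$ has a propagation probability $p_{(u,v)}\in(0,1]$. $C$ is a finite set of cascades; each $c\in C$ has a seed set $\tau(c)\subseteq V$. Each node is either inactive or $c$-active for exactly one $c\in C$, and once active it never changes state. Let $\pi_t(v)$ be the state of $v$ at step $t$. Each node $v$ has an activation function $F_v:2^{V\times C}\to C$ (needed only on the inputs that can arise) such that: (a) if $v$ is a seed of exactly the cascades in a nonempty $C'\subseteq C$, then at step 0 $v$ becomes $F_v(O)$-active with $O=\{(v,c):c\in C'\}$, and $F_v(O)\in C'$; (b) if $v$ is for the first time successfully activated at step $t$, by exactly the set $A$ of in-neighbors, then $v$ becomes $F_v(O)$-active with $O=\{(u,\pi_{t-1}(u)):u\in A\}$, and $F_v(O)\in\{\pi_{t-1}(u):u\in A\}$. Diffusion: at step 0 seeds are activated by (a), other nodes are inactive. At step $t\ge1$ each node $u$ activated at step $t-1$ makes one independent attempt to activate each inactive out-neighbor $v$, succeeding with probability $p_{(u,v)}$; nodes with at least one success are activated by (b). The process ends when no further activation is possible. MIM instance: a finite directed graph $G=(V,E)$ with propagation probabilities $p_{(u,v)}\in(0,1]$ on its edges, existing cascades $C_e=\{c_1,\dots,c_L\}$ with known seed sets $\tau(c_i)$, a new cascade $c_{new}$,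 $C=C_e\cup\{c_{new}\}$, activation functions $F_v$ over $C$ (known), a candidate set $V_c\subseteq V$, and $k\in\mathbb{Z}^+$. For $S\subseteq V$, $f(S)$ is the expected number of $c_{new}$-active nodes at the end when $S$ is the seed set of $c_{new}$. Max-MIM: find $S\subseteq V_c$ with $|S|=k$ maximizing $f(S)$. An algorithm has approximation ratio $\alpha\geq 1$ if it always returns a feasible $S$ with $\alpha f(S)\ge \max_{S'\subseteq V_c,|S'|=k} f(S')$. The notation $n^{1/\operatorname{poly}\log\log n}$ stands for $n^{1/(\log\log n)^{c}}$ for some universal constant $c>0$. *)

(* Defs.v *)
From HB Require Import structures.
From mathcomp Require Import all_boot all_order all_algebra.
From mathcomp Require Import reals exp.
Set Implicit Arguments.
Unset Strict Implicit.
Unset Printing Implicit Defensive.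
Import Order.TTheory GRing.Theory Num.Theory.
Local Open Scope ring_scope.

(** The arguments of [F_v] that can arise (for some choice of seed sets):
    either [v] is a seed of a nonempty set of cascades, or [v] is activated by
    a nonempty set of in-neighbours, each of which is in exactly one state.
    An attempt along a loop never takes place, since [v] would be active. *)
Definition seed_inputs (V C : finType) (v : V) : {set {set V * C}} :=
  [set O : {set V * C} | (O != set0) && [forall x in O, x.1 == v]].

Definition neighbour_inputs (V C : finType) (edge : rel V) (v : V) :
    {set {set V * C}} :=
  [set O : {set V * C} |
    [&& O != set0,
        [forall x in O, edge x.1 v && (x.1 != v)] &
        [forall x in O, forall y in O, (x.1 == y.1) ==> (x.2 == y.2)]]].

Definition inputs (V C : finType) (edge : rel V) (v : V) : {set {set V * C}} :=
  seed_inputs C v :|: neighbour_inputs C edge v.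

(** [act v] is the activation function [F_v]; [prob u v] and [act v O] are only
    meaningful when [edge u v], resp. when [O] can arise at [v]. *)
Record network (V C : finType) := Network {
  edge : rel V;
  prob : V -> V -> rat;
  act : V -> {set V * C} -> C;
  prob_edge : forall u v, edge u v -> 0 < prob u v <= 1;
  act_input : forall v O, O \in inputs C edge v ->
    act v O \in [set x.2 | x in O] }.

(** [pi v = None] means that [v] is inactive, [pi v = Some c] that it is
    [c]-active. *)
Definition state (V C : finType) := {ffun V -> option C}.

Definition init_state (V C : finType) (G : network V C) (tau : C -> {set V}) :
    state V C :=
  [ffun v => let C' := [set c | v \in tau c] in
             if C' == set0 then None
             else Some (act G v [set (v, c) | c in C'])].

Definition active (V C : finType) (pi : state V C) : {set V} :=
  [set v | pi v != None].

(** The attempts made at a step, [new] being the set of nodes that were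
    activated at the previous step and [pi] the current state. *)
Definition attempts (V C : finType) (G : network V C) (pi : state V C)
    (new : {set V}) : {set V * V} :=
  [set e | [&& e.1 \in new, edge G e.1 e.2 & pi e.2 == None]].

(** The next state when [X] is the set of the successful attempts. *)
Definition next_state (V C : finType) (G : network V C) (pi : state V C)
    (X : {set V * V}) : state V C :=
  [ffun v => if pi v is Some c then Some c else
             if [set u | (u, v) \in X] == set0 then None else
             Some (act G v [set x : V * C |
                             ((x.1, v) \in X) && (pi x.1 == Some x.2)])].

Definition outcome_prob (V C : finType) (G : network V C)
    (att X : {set V * V}) : rat :=
  \prod_(e in att) (if e \in X then prob G e.1 e.2 else 1 - prob G e.1 e.2).

Fixpoint expectation (V C : finType) (G : network V C) (phi : state V C -> rat)
    (t : nat) (pi : state V C) (new : {set V}) : rat :=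
  if t is t'.+1 then
    let att := attempts G pi new in
    \sum_(X : {set V * V} | X \subset att)
      outcome_prob G att X *
      (let pi' := next_state G pi X in
       expectation G phi t' pi' (active pi' :\: active pi))
  else phi pi.

(** Every step of the process but the last activates a new node, so that the
    process has ended after [#|V|] steps. *)
Definition expected_final (V C : finType) (G : network V C)
    (tau : C -> {set V}) (phi : state V C -> rat) : rat :=
  let pi0 := init_state G tau in expectation G phi #|V| pi0 (active pi0).

(** The cascades are [Some i] for the existing cascades and [None] for the new
    one.  The bound [mim_k <= #|mim_cand|] says that a feasible solution
    exists; without it no algorithm could always return one. *)
Record mim := Mim {
  mim_n : nat;
  mim_L : nat;
  mim_net : network 'I_mim_n (option 'I_mim_L);
  mim_tau : 'I_mim_L -> {set 'I_mim_n};
  mim_cand : {set 'I_mim_n};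
  mim_k : nat;
  mim_L_gt0 : (0 < mim_L)%N;
  mim_k_gt0 : (0 < mim_k)%N;
  mim_k_le : (mim_k <= #|mim_cand|)%N }.

Definition mim_seeds (I : mim) (S : {set 'I_(mim_n I)})
    (c : option 'I_(mim_L I)) : {set 'I_(mim_n I)} :=
  if c is Some i then mim_tau i else S.

Definition mim_value (I : mim) (S : {set 'I_(mim_n I)}) : rat :=
  expected_final (mim_net I) (mim_seeds S)
    (fun pi => #|[set v | pi v == Some None]|%:R).

Definition feasible (I : mim) (S : {set 'I_(mim_n I)}) : bool :=
  (S \subset mim_cand I) && (#|S| == mim_k I).

Inductive move := MoveLeft | Stay | MoveRight.

(** Tape symbols: [None] is the blank, [Some (inl b)] is the bit [b], and the
    remaining ones are auxiliary work symbols. *)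
Definition symbol (A : finType) : finType := option (bool + A)%type.

Record TM := MkTM {
  tm_tapes : nat;
  tm_work : finType;
  tm_state : finType;
  tm_start : tm_state;
  tm_halt : pred tm_state;
  tm_delta : tm_state -> tm_tapes.+1.-tuple (symbol tm_work) ->
    tm_state * tm_tapes.+1.-tuple (symbol tm_work * move) }.

(** A two-way infinite tape [(l, r)]: the head scans the first symbol of [r],
    and [l] is read from right to left; both sides are padded with blanks. *)
Definition tape (A : finType) : Type := seq (symbol A) * seq (symbol A).

Definition tape_read (A : finType) (t : tape A) : symbol A := head None t.2.

Definition tape_act (A : finType) (a : symbol A * move) (t : tape A) : tape A :=
  let: (s, m) := a in
  let: (l, r) := (t.1, behead t.2) in
  match m with
  | MoveLeft => (behead l, head None l :: s :: r)
  | Stay => (l, s :: r)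
  | MoveRight => (s :: l, r)
  end.

Definition config (M : TM) : Type :=
  tm_state M * (tm_tapes M).+1.-tuple (tape (tm_work M)).

Definition tm_init (M : TM) (w : seq bool) : config M :=
  (tm_start M,
   [tuple if i == ord0 then ([::], [seq Some (inl b) | b <- w])
          else ([::], [::]) | i < (tm_tapes M).+1]).

Definition tm_step (M : TM) (c : config M) : config M :=
  let: (q, ts) := c in
  if tm_halt q then c else
  let: (q', acts) := tm_delta q [tuple tape_read (tnth ts i) | i < _] in
  (q', [tuple tape_act (tnth acts i) (tnth ts i) | i < _]).

Fixpoint leading_bits (A : finType) (s : seq (symbol A)) : seq bool :=
  if s is Some (inl b) :: s' then b :: leading_bits s' else [::].

(** The output is the bit string that starts at the head of the first tape. *)
Definition tm_output (M : TM) (c : config M) : seq bool :=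
  leading_bits (tnth c.2 ord0).2.

Definition outputs_in (M : TM) (w : seq bool) (t : nat) (y : seq bool) : Prop :=
  let c := iter t (@tm_step M) (tm_init M w) in
  tm_halt c.1 /\ tm_output c = y.

(** Sizes and indices, which never exceed the number of objects of the input,
    are in unary (polynomially equivalent to binary here); probabilities are
    in binary. *)
Definition enc_nat (n : nat) : seq bool := rcons (nseq n true) false.

Definition enc_seq (T : Type) (enc : T -> seq bool) (s : seq T) : seq bool :=
  rcons (flatten [seq true :: enc x | x <- s]) false.

Definition enc_bin (n : nat) : seq bool :=
  enc_seq (fun i => [:: odd (n %/ 2 ^ i)]) (iota 0 (trunc_log 2 n).+1).

Definition enc_prob (p : rat) : seq bool :=
  enc_bin (absz (numq p)) ++ enc_bin (absz (denq p)).

Definition enc_set (T : finType) (A : {set T}) : seq bool :=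
  [seq x \in A | x <- enum T].

Definition enc_cascade (L : nat) (c : option 'I_L) : seq bool :=
  enc_nat (if c is Some i then i.+1 else 0%N).

(** [dom v] lists the inputs of [F_v]; the activation functions are given by
    their tables. *)
Definition enc_mim (I : mim)
    (dom : 'I_(mim_n I) -> seq {set 'I_(mim_n I) * option 'I_(mim_L I)}) :
    seq bool :=
  let G := mim_net I in
  enc_nat (mim_n I) ++ enc_nat (mim_L I)
  ++ flatten [seq if edge G e.1 e.2 then true :: enc_prob (prob G e.1 e.2)
                  else [:: false] | e <- enum {: 'I_(mim_n I) * 'I_(mim_n I)}]
  ++ flatten [seq enc_set (mim_tau i) | i <- enum 'I_(mim_L I)]
  ++ enc_set (mim_cand I) ++ enc_nat (mim_k I)
  ++ flatten [seq enc_seq (fun O => enc_set O ++ enc_cascade (act G v O)) (dom v)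
             | v <- enum 'I_(mim_n I)].

(** The entries of the tables may be listed in any order. *)
Definition encodes_mim (I : mim) (w : seq bool) : Prop :=
  exists2 dom : 'I_(mim_n I) -> seq {set 'I_(mim_n I) * option 'I_(mim_L I)},
    forall v, perm_eq (dom v) (enum (inputs _ (edge (mim_net I)) v)) &
    w = enc_mim dom.

(** A 3-CNF formula over [n] variables; the literal [(i, b)] holds when [x_i]
    has value [b].  Clauses with fewer than three literals are obtained by
    repetition. *)
Definition cnf3 (n : nat) := seq (3.-tuple ('I_n * bool)).

Definition satisfiable (n : nat) (phi : cnf3 n) : bool :=
  [exists x : {ffun 'I_n -> bool},
     all (fun cl : 3.-tuple _ => has (fun l => x l.1 == l.2) cl) phi].

Definition enc_cnf3 (n : nat) (phi : cnf3 n) : seq bool :=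
  enc_nat n ++
  enc_seq (fun cl : 3.-tuple ('I_n * bool) =>
             flatten [seq rcons (enc_nat l.1) l.2 | l : 'I_n * bool <- cl]) phi.

(** The factor polynomial in the length of [phi] is needed since the number [n]
    of variables does not bound that length: clauses may be repeated, and no
    algorithm can decide 3SAT without reading them. *)
Definition ETH (R : realType) : Prop :=
  exists2 delta : R, 0 < delta &
    forall (M : TM) (K d : nat),
    ~ (forall (n : nat) (phi : cnf3 n), exists2 t : nat,
         t%:R <= K%:R * 2 `^ (delta * n%:R) * (size (enc_cnf3 phi))%:R ^+ d &
         outputs_in M (enc_cnf3 phi) t [:: satisfiable phi]).

(** The ratio is only asked for on inputs with at least [n0] nodes, to allow for
    an [alpha] that is not meaningful for small [n]; feasibility and the running
    time are required on all inputs. *)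
Definition poly_approx_max_mim (R : realType) (M : TM) (n0 : nat)
    (alpha : nat -> R) : Prop :=
  exists K d : nat, forall (I : mim) (w : seq bool), encodes_mim I w ->
    exists (t : nat) (S : {set 'I_(mim_n I)}),
      [/\ (t <= K * size w ^ d)%N,
          outputs_in M w t (enc_set S),
          feasible S &
          (n0 <= mim_n I)%N ->
          forall S' : {set 'I_(mim_n I)}, feasible S' ->
            ratr (mim_value S') <= alpha (mim_n I) * ratr (mim_value S)].

(** [n ^ (1 / (log log n) ^ c)]; it makes sense for [n >= 3] only, where
    [log log n > 0]. *)
Definition loglog_ratio (R : realType) (c : R) (n : nat) : R :=
  n%:R `^ ((ln (ln n%:R)) `^ c)^-1.

(* Main.v *)
Require Import Defs.
From HB Require Import structures.
From mathcomp Require Import all_boot all_order all_algebra.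
From mathcomp Require Import boolp reals sequences exp.
From mathcomp Require Import zify ring lra.
Set Implicit Arguments.
Unset Strict Implicit.
Unset Printing Implicit Defensive.
Import Order.TTheory GRing.Theory Num.Theory.
Local Open Scope ring_scope.

(** Activation functions may be chosen freely, so a network in which every
    attempt succeeds can compute: layer [t] of a layered network holds the
    configuration, after [t] bits, of a program that reads a 3-CNF formula and
    evaluates it on the assignment given by the seeds.  The activation functions
    may only return the cascade of an in-neighbour; this costs nothing, as every
    node has an in-neighbour of each existing cascade.  The new cascade survives
    on a single row of [p] nodes, and at the last layer it may spread: to [p ^ 3]
    nodes if a certain node [z] is a seed and the assignment is satisfying, to
    [p ^ 2] nodes if [z] is not a seed.  Hence, up to a factor below [p / 2],
    optimal seed sets contain [z] exactly when the formula is satisfiable, while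
    the ratio is at most [sqrt p] for [c = 3].  A polynomial-time algorithm would
    thus decide 3SAT in polynomial time.

    The Turing machine that writes down the network interprets nested loops over
    [0, ..., p - 1] whose tests compare loop variables. *)

(** * Machines *)

(** An instance lists every activation function as a table over all inputs that can arise: nonempty
    sets of cascades at a seed, states of sets of in-neighbours elsewhere. These tables are
    exponential in the number of cascades and in the in-degree, so both must be constants
    independent of the formula. No node can then look at the whole assignment. The values and the
    bits of the formula therefore sit in a ring of cells and rotate: an index read in unary turns
    the values by one place per bit, so that the reader only inspects cell [0].

    The node [z] is there because an approximation algorithm returns a set and not a value. Both
    possible answers are forced by a gap ([p ^ 3] against [p + p ^ 2], or [p ^ 2] against [p]), so
    the answer is a single bit of the output and the value of the returned set is never computed.

    The exponent [3] comes from [2 ^ 3 = 8]: once the double logarithm of the number [N] of nodes is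
    at least [2], the ratio is at most the eighth root of [N], and [N <= p ^ 4]. *)

Section Machines.
Variables A X : finType.
Local Notation sym := (symbol A).

Definition zmove (m : move) : int :=
  match m with MoveLeft => -1 | Stay => 0 | MoveRight => 1 end.

(** Pairs of lists that differ in trailing blanks denote the same tape; a function on the integers
    is a canonical form, and all moves become additions. *)
Definition ztape : Type := (int -> sym) * int.

Definition zact (a : sym * move) (t : ztape) : ztape :=
  (fun i => if i == t.2 then a.1 else t.1 i, t.2 + zmove a.2).

Definition ztapes : Type := X -> ztape.

Definition heads (T : ztapes) : X -> sym := fun x => (T x).1 (T x).2.

Definition zact_all (a : X -> sym * move) (T : ztapes) : ztapes :=
  fun x => zact (a x) (T x).

(** [mexit q = Some b] when the machine has stopped with answer [b]. *)
Record mach := Mach {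
  mst : finType;
  mstart : mst;
  mexit : mst -> option bool;
  mdelta : mst -> (X -> sym) -> mst * (X -> sym * move) }.

Definition mstep (M : mach) (c : mst M * ztapes) : mst M * ztapes :=
  let a := mdelta c.1 (heads c.2) in (a.1, zact_all a.2 c.2).

Inductive reach (M : mach) : mst M * ztapes -> nat -> mst M * ztapes -> Prop :=
| reach0 c : reach c 0 c
| reachS c n c' : mexit c.1 = None -> reach (mstep c) n c' -> reach c n.+1 c'.

(** The exit bit lets tests and commands be one kind of machine. Only an upper bound on the time is
    kept, so costs can be rounded up freely. *)
Definition runs (M : mach) (T : ztapes) (B : nat) (b : bool) (T' : ztapes) :=
  exists q n, [/\ (n <= B)%N, reach (mstart M, T) n (q, T') & mexit q = Some b].

Lemma reach_trans (M : mach) (c c' c'' : mst M * ztapes) n m :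
  reach c n c' -> reach c' m c'' -> reach c (n + m) c''.
Proof. by elim=> // {}c k d hc _ IH /IH; apply: reachS. Qed.

Lemma runsW (M : mach) T B B' b T' :
  (B <= B')%N -> runs M T B b T' -> runs M T B' b T'.
Proof. by move=> h [q [n [hn r e]]]; exists q, n; split=> //; lia. Qed.

Definition keep (r : X -> sym) : X -> sym * move := fun x => (r x, Stay).

Lemma zact_read (t : ztape) m : zact (t.1 t.2, m) t = (t.1, t.2 + zmove m).
Proof.
case: t => f h; rewrite /zact /=; congr pair.
by apply/funext => i; case: eqP => [->|].
Qed.

Lemma zact_stay (T : ztapes) x : zact (heads T x, Stay) (T x) = T x.
Proof. by rewrite zact_read addr0; case: (T x). Qed.

Lemma zact_keep T : zact_all (keep (heads T)) T = T.
Proof.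
by apply/funext => x; exact: zact_stay.
Qed.

Definition Atom (f : (X -> sym) -> bool * (X -> sym * move)) : mach :=
  @Mach (option bool) None id (fun _ r => (Some (f r).1, (f r).2)).

Lemma runs_Atom f T :
  runs (Atom f) T 1 (f (heads T)).1 (zact_all (f (heads T)).2 T).
Proof.
exists (Some (f (heads T)).1), 1%N; split=> //.
by apply: reachS => //; apply: reach0.
Qed.

Definition Ite (M1 M2 M3 : mach) : mach :=
  @Mach (mst M1 + (mst M2 + mst M3))%type (inl (mstart M1))
    (fun q => match q with
              | inl _ => None
              | inr (inl q) => mexit q
              | inr (inr q) => mexit q
              end)
    (fun q r => match q with
       | inl q => if mexit q is Some b
                  then (inr (if b then inl (mstart M2) else inr (mstart M3)),
                        keep r)
                  else let a := mdelta q r in (inl a.1, a.2)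
       | inr (inl q) => let a := mdelta q r in (inr (inl a.1), a.2)
       | inr (inr q) => let a := mdelta q r in (inr (inr a.1), a.2)
       end).

Lemma runs_Ite (M1 M2 M3 : mach) T n b T1 n' b' T2 :
  runs M1 T n b T1 -> runs (if b then M2 else M3) T1 n' b' T2 ->
  runs (Ite M1 M2 M3) T (n + n').+1 b' T2.
Proof.
move=> [q [k [hk r e]]] h2.
have h1 : reach (M := Ite M1 M2 M3) (inl (mstart M1), T) k (inl q, T1).
  move: r; move: (mstart M1) => q0 r.
  have: reach (M := Ite M1 M2 M3) (inl (q0, T).1, (q0, T).2) k
          (inl (q, T1).1, (q, T1).2) by
    elim: r => [c|c m c' hc _ IH]; [exact: reach0|];
    apply: reachS => //; rewrite /mstep /= hc.
  by [].
have h3 : mstep (M := Ite M1 M2 M3) (inl q, T1) =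
    (inr (if b then inl (mstart M2) else inr (mstart M3)), T1).
  by rewrite /mstep /= e /= zact_keep.
case: b h2 e h3 => -[q2 [k2 [hk2 r2 e2]]] e h3.
- exists (inr (inl q2)), (k + k2.+1)%N; split=> //; first lia.
  apply: reach_trans h1 _; apply: reachS => //; rewrite h3.
  move: r2; move: (mstart M2) => q0 r2.
  have: reach (M := Ite M1 M2 M3) (inr (inl (q0, T1).1), (q0, T1).2) k2
          (inr (inl (q2, T2).1), (q2, T2).2) by
    elim: r2 => [c|c m c' hc _ IH]; [exact: reach0|]; apply: reachS.
  by [].
- exists (inr (inr q2)), (k + k2.+1)%N; split=> //; first lia.
  apply: reach_trans h1 _; apply: reachS => //; rewrite h3.
  move: r2; move: (mstart M3) => q0 r2.
  have: reach (M := Ite M1 M2 M3) (inr (inr (q0, T1).1), (q0, T1).2) k2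
          (inr (inr (q2, T2).1), (q2, T2).2) by
    elim: r2 => [c|c m c' hc _ IH]; [exact: reach0|]; apply: reachS.
  by [].
Qed.

Definition Then (M1 M2 : mach) : mach := Ite M1 M2 M2.

Lemma runs_Then (M1 M2 : mach) T n b T1 n' b' T2 :
  runs M1 T n b T1 -> runs M2 T1 n' b' T2 ->
  runs (Then M1 M2) T (n + n').+1 b' T2.
Proof. by move=> h1 h2; apply: runs_Ite h1 _; case: b. Qed.

Definition Repeat (M : mach) : mach :=
  @Mach (mst M) (mstart M)
    (fun q => if mexit q is Some false then Some true else None)
    (fun q r => if mexit q is Some true then (mstart M, keep r)
                else mdelta q r).

Lemma reach_Repeat (M : mach) c n c' :
  reach (M := M) c n c' -> reach (M := Repeat M) c n c'.
Proof.
elim=> [d|d m d' hd _ IH]; first exact: reach0.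
by apply: reachS; rewrite /mstep /= hd.
Qed.

Lemma runs_Repeat_stop (M : mach) T n T' :
  runs M T n false T' -> runs (Repeat M) T n true T'.
Proof.
move=> [q [k [hk r e]]]; exists q, k; split=> //; last by rewrite /= e.
exact: reach_Repeat.
Qed.

Lemma runs_Repeat_next (M : mach) T n T1 n' b T2 :
  runs M T n true T1 -> runs (Repeat M) T1 n' b T2 ->
  runs (Repeat M) T (n + n').+1 b T2.
Proof.
move=> [q [k [hk r e]]] [q2 [k2 [hk2 r2 e2]]].
exists q2, (k + k2.+1)%N; split=> //; first lia.
apply: reach_trans (reach_Repeat r) _; apply: reachS; first by rewrite /= e.
by rewrite /mstep /= e /= zact_keep.
Qed.

Definition Quit : mach := Atom (fun r => (false, keep r)).

Definition Loop (g : (X -> sym) -> bool) (M : mach) : mach :=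
  Repeat (Ite (Atom (fun r => (g r, keep r))) M Quit).

(** [F i] stands for the tapes after [i] rounds. A round is the test, the body and two control
    steps, hence [B + 3]; the last, failing test takes three steps. *)
Lemma runs_Loop (g : (X -> sym) -> bool) (M : mach) (F : nat -> ztapes) (n B : nat) :
  (forall i, (i < n)%N -> g (heads (F i))) -> ~~ g (heads (F n)) ->
  (forall i, (i < n)%N -> runs M (F i) B true (F i.+1)) ->
  runs (Loop g M) (F 0%N) (n * (B + 3) + 3)%N true (F n).
Proof.
move=> hg hn hM.
suff H m k : (k + m = n)%N ->
    runs (Loop g M) (F k) (m * (B + 3) + 3)%N true (F n) by exact: (H n 0%N).
elim: m k => [|m IH] k e.
  have -> : k = n by lia.
  apply: runs_Repeat_stop; apply: runsW (_ : ((1 + 1).+1 <= _)%N) _; first lia.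
  apply: (@runs_Ite _ _ _ _ _ false (F n)).
    have := runs_Atom (fun r => (g r, keep r)) (F n).
    by rewrite /= zact_keep (negPf hn).
  by have := runs_Atom (fun r => (false, keep r)) (F n); rewrite /= zact_keep.
apply: runsW (_ : (((1 + B).+1 + (m * (B + 3) + 3)).+1 <= _)%N) _; first nia.
apply: runs_Repeat_next (IH k.+1 _); last lia.
apply: (@runs_Ite _ _ _ _ _ true (F k)); last by apply: hM; lia.
have := runs_Atom (fun r => (g r, keep r)) (F k).
by rewrite /= zact_keep hg //; lia.
Qed.

End Machines.

(** * Tapes as lists and tapes as functions *)

Section Lists.
Variable A : finType.

Definition rep (t : tape A) (a : ztape A) : Prop :=
  forall i : nat, nth None t.1 i = a.1 (a.2 - 1 - i%:Z) /\
                  nth None t.2 i = a.1 (a.2 + i%:Z).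

Lemma rep_read t a : rep t a -> tape_read t = a.1 a.2.
Proof. by move=> /(_ 0%N) [_]; rewrite addr0 nth0. Qed.

Lemma rep_act x t a : rep t a -> rep (tape_act x t) (zact x a).
Proof.
case: x => s m h i.
have hl j : nth None t.1 j = a.1 (a.2 - 1 - j%:Z) by have [] := h j.
have hr j : nth None t.2 j = a.1 (a.2 + j%:Z) by have [] := h j.
rewrite /zact /tape_act; case: m => /=; split.
- rewrite nth_behead hl; have -> /= : (a.2 + -1 - 1 - i%:Z == a.2) = false by lia.
  by congr (a.1 _); lia.
- case: i => [|[|i]] /=.
  + rewrite -nth0 hl; have -> /= : (a.2 + -1 + 0 == a.2) = false by lia.
    by congr (a.1 _); lia.
  + by have -> /= : (a.2 + -1 + 1 == a.2) = true by lia.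
  + rewrite nth_behead hr.
    have -> /= : (a.2 + -1 + i.+2%:Z == a.2) = false by lia.
    by congr (a.1 _); lia.
- rewrite hl; have -> /= : (a.2 + 0 - 1 - i%:Z == a.2) = false by lia.
  by congr (a.1 _); lia.
- case: i => [|i] /=; first by have -> /= : (a.2 + 0 + 0 == a.2) = true by lia.
  rewrite nth_behead hr.
  have -> /= : (a.2 + 0 + i.+1%:Z == a.2) = false by lia.
  by congr (a.1 _); lia.
- case: i => [|i] /=.
    by have -> /= : (a.2 + 1 - 1 - 0 == a.2) = true by lia.
  rewrite hl; have -> /= : (a.2 + 1 - 1 - i.+1%:Z == a.2) = false by lia.
  by congr (a.1 _); lia.
- rewrite nth_behead hr.
  have -> /= : (a.2 + 1 + i%:Z == a.2) = false by lia.
  by congr (a.1 _); lia.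
Qed.

Definition bits_at (w : seq bool) (i : int) : symbol A :=
  if i is Posz n then nth None [seq Some (inl b) | b <- w] n else None.

Lemma rep_bits w : rep ([::], [seq Some (inl b) | b <- w]) (bits_at w, 0).
Proof.
move=> i; rewrite [(_, _).2]/= add0r; split; last by [].
by have -> : 0 - 1 - i%:Z = Negz i; rewrite ?NegzE /= ?nth_nil //; lia.
Qed.

Definition blank (_ : int) : symbol A := None.

Lemma rep_blank h : rep ([::], [::]) (blank, h).
Proof. by move=> i; rewrite /= nth_nil. Qed.

End Lists.

(** * Running a Turing machine inside a larger machine *)

Section Simulation.
Variables (M : TM) (Y : finType).
Local Notation X := (option ('I_(tm_tapes M).+1 + Y)).
Local Notation A := (tm_work M).

Definition sim : mach A X :=
  @Mach A X (tm_state M) (tm_start M)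
    (fun q => if tm_halt q then Some true else None)
    (fun q r => let a := tm_delta q [tuple r (Some (inl i)) | i < _] in
      (a.1, fun x => if x is Some (inl i) then tnth a.2 i else (r x, Stay))).

(** The approximation algorithm is run this way. Tapes that do not belong to [M] survive, which
    keeps the input tape available for the final answer. *)
Lemma runs_sim w t y (T : ztapes A X) :
  outputs_in M w t y ->
  (forall i, rep (tnth (tm_init M w).2 i) (T (Some (inl i)))) ->
  exists2 T', runs sim T t true T' &
    [/\ T' None = T None,
        forall j, T' (Some (inr j)) = T (Some (inr j)) &
        exists l r, rep (l, r) (T' (Some (inl ord0))) /\
                    leading_bits r = y].
Proof.
(* The start state is rewritten through [tm_init] so that the induction ranges over all
   configurations. *)
rewrite /outputs_in /runs (_ : mstart sim = (tm_init M w).1) //.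
elim: t (tm_init M w) T => [|t IH] c T.
  move=> [h o] R; exists T.
    by exists c.1, 0%N; split; [|exact: reach0|move: h => /= ->].
  split=> //; exists (tnth c.2 ord0).1, (tnth c.2 ord0).2; split; last exact: o.
  by move: (R ord0); case: (tnth c.2 ord0).
rewrite iterSr => h R.
case: (boolP (tm_halt c.1)) => hc.
  have e : tm_step c = c by case: c hc {h R} => q ts /= ->.
  rewrite e in h; have [T' [q [n [hn r' e']]] H] := IH _ _ h R.
  by exists T' => //; exists q, n; split=> //; lia.
pose d := mstep (M := sim) (c.1, T).
have h1 : d.1 = (tm_step c).1 /\
    forall i, rep (tnth (tm_step c).2 i) (d.2 (Some (inl i))).
  rewrite /d; case: c hc {h d} R => q ts /= hq R.
  rewrite /mstep /tm_step (negPf hq) /=.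
  have -> : [tuple heads T (Some (inl i)) | i < (tm_tapes M).+1] =
            [tuple tape_read (tnth ts i)  | i < (tm_tapes M).+1].
    by apply: eq_from_tnth => i; rewrite !tnth_mktuple (rep_read (R i)).
  case: (tm_delta _ _) => q' acts /=; split=> // i.
  by rewrite tnth_mktuple; apply: rep_act.
have [T' [q [n [hn r' e']]] [H1 H2 H3]] := IH _ _ h h1.2.
exists T'.
  exists q, n.+1; split=> //; apply: reachS; first by rewrite /= (negPf hc).
  by rewrite -h1.1 in r'; move: r'; rewrite -surjective_pairing.
split=> //.
- by rewrite H1 /d /= /zact_all zact_read addr0; case: (T None).
- by move=> j; rewrite H2 /d /= /zact_all zact_read addr0; case: (T _).
Qed.

End Simulation.

(** * Back to Turing machines *)

Section Realisation.
Variables (A Y : finType) (M : mach A (option Y)).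

Definition tape_of (i : 'I_#|Y|.+1) : option Y := omap enum_val (unlift ord0 i).

Definition rank_of (x : option Y) : 'I_#|Y|.+1 :=
  if x is Some y then lift ord0 (enum_rank y) else ord0.

Lemma rank_ofK : cancel rank_of tape_of.
Proof. by case=> [y|]; rewrite /tape_of /= ?liftK /= ?enum_rankK ?unlift_none. Qed.

Definition tm_of : TM :=
  @MkTM #|Y| A (mst M) (mstart M) (fun q => mexit q != None)
    (fun q r => let a := mdelta q (fun x => tnth r (rank_of x)) in
       (a.1, [tuple a.2 (tape_of i) | i < #|Y|.+1])).

(** The blank after [c] is required because the output is the maximal run of bits that starts at the
    head. *)
Lemma tm_of_outputs w T B b T' c :
  runs M T B b T' ->
  T None = (bits_at A w, 0) -> (forall y, T (Some y) = (blank A, 0)) ->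
  (T' None).1 (T' None).2 = Some (inl c) ->
  (T' None).1 ((T' None).2 + 1) = None ->
  exists2 t, (t <= B)%N & outputs_in tm_of w t [:: c].
Proof.
move=> [q [n [hn r e]]] h0 hY o1 o2; exists n => //.
suff: (iter n (@tm_step tm_of) (tm_init tm_of w)).1 = q /\
      forall x, rep (tnth (iter n (@tm_step tm_of) (tm_init tm_of w)).2
                      (rank_of x)) (T' x).
  rewrite /outputs_in; case: (iter n _ _) => q' ts /= [-> R]; split; first by rewrite e.
  have := R None; rewrite /tm_output /=; case: (tnth _ _) => l s /= {}R.
  have [_ /=] := R 0%N; rewrite addr0 o1; have [_ /=] := R 1%N; rewrite o2.
  case: s {R} => [|s0 [|s1 s]] /=; first by [].
    by move=> _ ->.
  by move=> -> ->.
have : forall x, rep (tnth (tm_init tm_of w).2 (rank_of x)) (T x).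
  move=> x; rewrite /tm_init /= tnth_mktuple.
  case: x => [y|] /=; first by rewrite hY; exact: rep_blank.
  by rewrite h0; exact: rep_bits.
have: (tm_init tm_of w).1 = mstart M by [].
move: r (tm_init tm_of w); move: (mstart M) => q0 r.
change T with (q0, T).2; change q0 with (q0, T).1 at 1 2.
change T' with (q, T').2; change q with (q, T').1.
elim: r => [c0|c0 m c1 hc _ IH] d e1 R //=.
rewrite -iterS iterSr; apply: IH.
- case: d e1 R => q1 ts /= -> R; rewrite hc /=.
  congr (mdelta _ _).1; apply/funext => x.
  by rewrite tnth_mktuple (rep_read (R x)).
- case: d e1 R => q1 ts /= -> R x; rewrite hc /=.
  rewrite !tnth_mktuple rank_ofK.
  have -> : (fun x0 => tnth [tuple tape_read (tnth ts i) | i < #|Y|.+1] (rank_of x0))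
            = heads c0.2.
    by apply/funext => z; rewrite tnth_mktuple (rep_read (R z)).
  exact: rep_act.
Qed.

End Realisation.

(** * A language of bounded loops *)

Section Nudge.
Variables A X : finType.

Definition nudge (d : X -> move) : mach A X :=
  Atom (fun r => (true, fun x => (r x, d x))).

Lemma runs_nudge d (T : ztapes A X) :
  runs (nudge d) T 1 true (fun x => ((T x).1, (T x).2 + zmove (d x))).
Proof.
have := runs_Atom (fun r => (true, fun x => (r x, d x))) T.
by congr runs; apply/funext => x; rewrite /zact_all zact_read.
Qed.

Definition set_tape (T : ztapes A X) x t : ztapes A X :=
  fun y => if y == x then t else T y.

Definition one (x : X) (m : move) : X -> move :=
  fun y => if y == x then m else Stay.

Lemma runs_one x m (T : ztapes A X) :
  runs (nudge (one x m)) T 1 true (set_tape T x ((T x).1, (T x).2 + zmove m)).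
Proof.
have := runs_nudge (one x m) T; congr runs; apply/funext => y.
rewrite /one /set_tape; case: eqP => [->//|_].
by rewrite addr0; case: (T y).
Qed.

(** The head starts on the blank behind the text, leaves it, walks to the blank in front of the text
    and steps back. The empty text needs no special treatment. *)
Definition rewind (x : X) : mach A X :=
  Then (nudge (one x MoveLeft))
    (Then (Loop (fun r => r x != None) (nudge (one x MoveLeft)))
          (nudge (one x MoveRight))).

Lemma bits_at_None (w : seq bool) (i : int) :
  (bits_at A w i != None) = (0 <= i < (size w)%:Z).
Proof.
case: i => i //; have -> : (0 <= i%:Z < (size w)%:Z) = (i < size w)%N by lia.
rewrite /bits_at; case: ltnP => h; last by rewrite nth_default ?size_map.
by rewrite (nth_map false).
Qed.

Lemma runs_rewind (T : ztapes A X) x o :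
  T x = (bits_at A o, (size o)%:Z) ->
  runs (rewind x) T (4 * size o + 8)%N true (set_tape T x (bits_at A o, 0)).
Proof.
move=> hx.
pose F (i : nat) := set_tape T x (bits_at A o, (size o)%:Z - 1 - i%:Z).
have F1 i : heads (F i) x = bits_at A o ((size o)%:Z - 1 - i%:Z).
  by rewrite /heads /F /set_tape eqxx.
have FF i t : set_tape (F i) x t = set_tape T x t.
  by apply/funext => y; rewrite /F /set_tape; case: eqP.
have -> : set_tape T x (bits_at A o, 0) =
    set_tape (F (size o)) x ((F (size o) x).1, (F (size o) x).2 + 1).
  rewrite FF; congr set_tape; rewrite /F /set_tape eqxx /=; congr pair; lia.
apply: runsW (_ : ((1 + ((size o * (1 + 3) + 3) + 1).+1).+1 <= _)%N) _.
  lia.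
apply: (@runs_Then _ _ _ _ _ _ true (F 0%N)).
  have := runs_one x MoveLeft T; rewrite hx /=; congr runs.
  by rewrite /F; congr set_tape; congr pair; rewrite subr0.
apply: (@runs_Then _ _ _ _ _ _ true (F (size o))); last exact: runs_one.
apply: runs_Loop.
- by move=> i hi; rewrite F1 bits_at_None; lia.
- by rewrite F1 bits_at_None; lia.
- move=> i hi; have := runs_one x MoveLeft (F i); rewrite FF; congr runs.
  rewrite /F /set_tape eqxx; apply/funext => y; case: (y =P x) => //= _.
  by congr pair; lia.
Qed.

End Nudge.

Section Loops.
Variables (Var Aux : finType) (ivar : Var).
Variables (coef : Aux -> Var -> move) (shift0 shiftp : Aux -> move).
Variables (zat eat : Var -> Aux).

(** The auxiliary tape [j] holds one mark, and its head is kept at distance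
    [offset j p e] from it, [p] being the common bound of the loops and [e] the
    values of the loop variables.  Thus comparisons between loop variables are
    made by looking at a single symbol. *)
Definition offset (j : Aux) (p : nat) (e : Var -> nat) : int :=
  zmove (shift0 j) + p%:Z * zmove (shiftp j) +
  \sum_(x : Var) (e x)%:Z * zmove (coef j x).

Hypothesis zatE : forall x p e, offset (zat x) p e = (e x)%:Z.
Hypothesis eatE : forall x p e, offset (eat x) p e = (e x)%:Z - p%:Z.

Inductive cmd :=
| Emit (s : seq bool)
| Cat (c1 c2 : cmd)
| IfC (f : (option Aux -> bool) -> bool) (c1 c2 : cmd)
| For (x : Var) (c : cmd).

Definition view (w : seq bool) (p : nat) (e : Var -> nat) (a : option Aux) :=
  if a is Some j then offset j p e == 0 else nth false w (e ivar).

Definition upd (e : Var -> nat) (x : Var) (n : nat) : Var -> nat :=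
  fun y => if y == x then n else e y.

Fixpoint out (w : seq bool) (p : nat) (c : cmd) (e : Var -> nat) : seq bool :=
  match c with
  | Emit s => s
  | Cat c1 c2 => out w p c1 e ++ out w p c2 e
  | IfC f c1 c2 => if f (view w p e) then out w p c1 e else out w p c2 e
  | For x c => flatten [seq out w p c (upd e x i) | i <- iota 0 p]
  end.

Fixpoint bound (c : cmd) : seq Var :=
  match c with
  | Emit _ => [::]
  | Cat c1 c2 | IfC _ c1 c2 => bound c1 ++ bound c2
  | For x c => x :: bound c
  end.

(** A loop expects its variable to be [0] and restores [0] at the end. Consecutive loops may thus
    share a variable, nested ones may not. *)
Fixpoint wf (c : cmd) : bool :=
  match c with
  | Emit _ => true
  | Cat c1 c2 | IfC _ c1 c2 => wf c1 && wf c2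
  | For x c => (x \notin bound c) && wf c
  end.

(** One function bounds both the running time and the output length. In a loop, a round costs [5]
    steps besides the body and [4] more when the variable is counted back to [0]. *)
Fixpoint cost (p : nat) (c : cmd) : nat :=
  match c with
  | Emit s => 2 * size s + 1
  | Cat c1 c2 => (cost p c1 + cost p c2).+1
  | IfC _ c1 c2 => (cost p c1 + cost p c2).+2
  | For _ c => p * (cost p c + 9) + 7
  end%N.

Lemma size_out w p c e : (size (out w p c e) <= cost p c)%N.
Proof.
elim: c e => [s|c1 IH1 c2 IH2|f c1 IH1 c2 IH2|x c IH] e /=.
- lia.
- by rewrite size_cat; have := IH1 e; have := IH2 e; lia.
- by have := IH1 e; have := IH2 e; case: ifP => _; lia.
- rewrite size_flatten /shape -map_comp sumnE big_map.
  apply: leq_trans (_ : \sum_(i <- iota 0 p) cost p c <= _)%N.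
    by apply: leq_sum => i _ /=; apply: IH.
  rewrite big_const_seq count_predT size_iota iter_addn_0; nia.
Qed.

Lemma cost_poly c :
  exists K d, forall p, (0 < p)%N -> (cost p c <= K * p ^ d)%N.
Proof.
elim: c => [s|c1 [K1 [d1 H1]] c2 [K2 [d2 H2]]
           |f c1 [K1 [d1 H1]] c2 [K2 [d2 H2]]|x c [K [d H]]].
- by exists (2 * size s + 1)%N, 0%N => p hp; rewrite muln1.
- exists (K1 + K2 + 1)%N, (d1 + d2)%N => p hp /=.
  have := H1 p hp; have := H2 p hp; rewrite expnD.
  have : (0 < p ^ d1)%N by rewrite expn_gt0 hp.
  have : (0 < p ^ d2)%N by rewrite expn_gt0 hp.
  move: (p ^ d1)%N (p ^ d2)%N => a b; nia.
- exists (K1 + K2 + 2)%N, (d1 + d2)%N => p hp /=.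
  have := H1 p hp; have := H2 p hp; rewrite expnD.
  have : (0 < p ^ d1)%N by rewrite expn_gt0 hp.
  have : (0 < p ^ d2)%N by rewrite expn_gt0 hp.
  move: (p ^ d1)%N (p ^ d2)%N => a b; nia.
- exists (K + 16)%N, d.+1 => p hp /=; have := H p hp; rewrite expnS.
  have : (0 < p ^ d)%N by rewrite expn_gt0 hp.
  move: (p ^ d)%N => a; nia.
Qed.

(** * Compilation of bounded loops *)

Section Compile.
Variables (A : finType) (m : nat).
Local Notation X := (option ('I_m.+1 + Aux)).

Definition mark (i : int) : symbol A := if i == 0 then Some (inl true) else None.

(** The invariant between commands. The input head follows the variable [ivar], so looking up the
    bit with that index takes no search; the output head stays behind the last bit written. *)
Definition store w p (e : Var -> nat) (o : seq bool) : ztapes A X :=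
  fun x => match x with
  | None => (bits_at A w, (e ivar)%:Z)
  | Some (inl i) => if i == ord0 then (bits_at A o, (size o)%:Z) else (@blank A, 0)
  | Some (inr j) => (mark, offset j p e)
  end.

Definition opposite (d : move) : move :=
  match d with MoveLeft => MoveRight | Stay => Stay | MoveRight => MoveLeft end.

Definition succ_moves (v : Var) (x : X) : move :=
  match x with
  | None => if v == ivar then MoveRight else Stay
  | Some (inl _) => Stay
  | Some (inr j) => coef j v
  end.

Definition put (b : bool) : mach A X :=
  Atom (fun r => (true, fun x => if x == Some (inl ord0)
                                 then (Some (inl b), MoveRight)
                                 else (r x, Stay))).

Definition seen (r : X -> symbol A) (a : option Aux) : bool :=
  r (omap inr a) == Some (inl true).

Fixpoint comp (c : cmd) : mach A X :=
  match c with
  | Emit s => foldr (fun b => Then (put b)) (nudge A (fun _ => Stay)) s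
  | Cat c1 c2 => Then (comp c1) (comp c2)
  | IfC f c1 c2 =>
      Ite (Atom (fun r => (f (seen r), keep r))) (comp c1) (comp c2)
  | For v c =>
      Then (Loop (fun r => ~~ seen r (Some (eat v)))
              (Then (comp c) (nudge A (succ_moves v))))
           (Loop (fun r => ~~ seen r (Some (zat v)))
              (nudge A (fun x => opposite (succ_moves v x))))
  end.

Lemma seen_store w p e o : seen (heads (store w p e o)) = view w p e.
Proof.
apply/funext => -[j|]; rewrite /seen /heads /=.
  by rewrite /mark; case: ifP.
case: (ltnP (e ivar) (size w)) => h; last by rewrite !nth_default ?size_map.
by rewrite (nth_map false) //; case: nth.
Qed.

(** Linearity of [offset]: raising a variable by one moves each auxiliary head by at most one
    cell. *)
Lemma offset_upd j p e v n :
  offset j p (upd e v n) = offset j p e + (n%:Z - (e v)%:Z) * zmove (coef j v).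
Proof.
rewrite /offset -[RHS]addrA; congr (_ + _).
rewrite (bigD1 v) //= [X in _ = X + _](bigD1 v) //= /upd eqxx.
rewrite (eq_bigr (fun i => (e i)%:Z * zmove (coef j i))); last first.
  by move=> i /negPf ->.
by ring.
Qed.

Lemma upd_id e v : upd e v (e v) = e.
Proof. by apply/funext => x; rewrite /upd; case: eqP => // ->. Qed.

Lemma runs_succ w p e o v n :
  runs (nudge A (succ_moves v)) (store w p (upd e v n) o) 1 true
    (store w p (upd e v n.+1) o).
Proof.
have := runs_nudge (succ_moves v) (store w p (upd e v n) o); congr runs.
apply/funext => -[[i|j]|] /=.
- by case: eqP => _; rewrite addr0.
- by congr pair; rewrite !offset_upd; lia.
- by congr pair; rewrite /upd eq_sym; case: eqP => _ /=; lia.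
Qed.

Lemma runs_pred w p e o v n :
  runs (nudge A (fun x => opposite (succ_moves v x)))
    (store w p (upd e v n.+1) o) 1 true (store w p (upd e v n) o).
Proof.
have := runs_nudge (fun x => opposite (succ_moves v x))
          (store w p (upd e v n.+1) o); congr runs.
apply/funext => -[[i|j]|] /=.
- by case: eqP => _; rewrite addr0.
- by congr pair; rewrite !offset_upd; case: (coef j v) => /=; lia.
- by congr pair; rewrite /upd eq_sym; case: eqP => _ /=; lia.
Qed.

Lemma bits_at_rcons o b :
  bits_at A (rcons o b) =
  (fun i => if i == (size o)%:Z then Some (inl b) else bits_at A o i).
Proof.
apply/funext => -[n|n] //=; rewrite map_rcons nth_rcons size_map eqz_nat.
by case: ltngtP => // h; rewrite nth_default // size_map ltnW.
Qed.

Lemma runs_put w p e o b :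
  runs (put b) (store w p e o) 1 true (store w p e (rcons o b)).
Proof.
have := runs_Atom (fun r => (true, fun x : X => if x == Some (inl ord0)
                                 then (Some (inl b), MoveRight)
                                 else (r x, Stay))) (store w p e o).
congr runs; apply/funext => x; rewrite /zact_all.
case: (altP (x =P Some (inl ord0))) => [->|].
  by rewrite /zact /= -bits_at_rcons size_rcons; congr pair; lia.
move=> hi; rewrite [(_, _).2 _]/= (negPf hi) zact_stay.
case: x hi => [[i|j]|] //= hi.
by case: eqP => // ei; rewrite ei eqxx in hi.
Qed.

Lemma runs_comp w p c e o :
  wf c -> (forall x, x \in bound c -> e x = 0%N) ->
  runs (comp c) (store w p e o) (cost p c) true (store w p e (o ++ out w p c e)).
Proof.
elim: c e o => [s|c1 IH1 c2 IH2|f c1 IH1 c2 IH2|v c IH] e o /=.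
- move=> _ _; elim: s o => [|b s IH] o /=.
    have := runs_nudge (fun _ => Stay) (store w p e o); congr runs.
    by apply/funext => x; rewrite addr0 cats0; case: (store _ _ _ _ _).
  rewrite -cat_rcons; apply: runsW (runs_Then (runs_put w p e o b) (IH _)); lia.
- move=> /andP[w1 w2] b; rewrite catA.
  apply: runsW (_ : ((cost p c1 + cost p c2).+1 <= _)%N) _ => //.
  apply: runs_Then (IH1 _ _ w1 _) (IH2 _ _ w2 _) => x hx; apply: b;
  by rewrite mem_cat hx ?orbT.
- move=> /andP[w1 w2] b.
  apply: runsW (_ : ((1 + (cost p c1 + cost p c2)).+1 <= _)%N) _ => //.
  have h := runs_Atom (fun r => (f (seen r), keep r)) (store w p e o).
  rewrite /= zact_keep seen_store in h; apply: runs_Ite h _; case: ifP => _.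
    apply: runsW (IH1 _ _ w1 _); first lia.
    by move=> x hx; apply: b; rewrite mem_cat hx.
  apply: runsW (IH2 _ _ w2 _); first lia.
  by move=> x hx; apply: b; rewrite mem_cat hx orbT.
- move=> /andP[hv wc] b.
  have ev : e v = 0%N by apply: b; rewrite inE eqxx.
  pose o' i := o ++ flatten [seq out w p c (upd e v j) | j <- iota 0 i].
  pose F i := store w p (upd e v i) (o' i).
  pose G i := store w p (upd e v (p - i)%N) (o' p).
  apply: runsW (_ : (((p * ((cost p c + 1).+1 + 3) + 3) +
                      (p * (1 + 3) + 3)).+1 <= _)%N) _; first lia.
  apply: (@runs_Then _ _ _ _ _ _ true (F p)).
    have -> : store w p e o = F 0%N by rewrite /F /o' cats0 -ev upd_id.
    apply: runs_Loop.
    + move=> i hi; rewrite seen_store /= eatE /upd eqxx; lia.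
    + rewrite seen_store /= eatE /upd eqxx; lia.
    + move=> i hi; apply: runs_Then (IH _ _ wc _) _.
        move=> x hx; rewrite /upd; case: eqP hv => [<-|_ _]; first by rewrite hx.
        by apply: b; rewrite inE hx orbT.
      rewrite /F -catA.
      have -> : flatten [seq out w p c (upd e v j) | j <- iota 0 i] ++
             out w p c (upd e v i) =
             flatten [seq out w p c (upd e v j) | j <- iota 0 i.+1].
        by rewrite -addn1 iotaD map_cat flatten_cat /= cats0.
      exact: runs_succ.
  have -> : F p = G 0%N by rewrite /G subn0.
  have -> : store w p e (o ++ flatten [seq out w p c (upd e v i) | i <- iota 0 p]) = G p.
    by rewrite /G subnn -{1}(upd_id e v) ev.
  apply: runs_Loop.
  + move=> i hi; rewrite seen_store /= zatE /upd eqxx; lia.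
  + rewrite seen_store /= zatE /upd eqxx; lia.
  + move=> i hi; rewrite /G.
    have -> : (p - i = (p - i.+1).+1)%N by lia.
    exact: runs_pred.
Qed.

Fixpoint times (n : nat) (M : mach A X) : mach A X :=
  if n is n'.+1 then Then M (times n' M) else nudge A (fun _ => Stay).

(** The bound [p = size w + pad] is never written down: the heads that depend on it move once per
    input symbol and then [pad] more times. *)
Definition setup (pad : nat) : mach A X :=
  let aux (d : Aux -> move) (m0 : move) x :=
    match x with Some (inr j) => d j | None => m0 | _ => Stay end in
  Then (Atom (fun r => (true, fun x =>
          if x is Some (inr j) then (Some (inl true), shift0 j) else (r x, Stay))))
  (Then (Loop (fun r => r None != None) (nudge A (aux shiftp MoveRight)))
  (Then (times pad (nudge A (aux shiftp Stay)))
        (rewind A None))).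

Lemma runs_setup pad w :
  runs (setup pad)
    (fun x : X => if x is None then (bits_at A w, 0) else (@blank A, 0))
    (8 * size w + 2 * pad + 16) true
    (store w (size w + pad) (fun _ => 0%N) [::]).
Proof.
pose I (a b : nat) : ztapes A X := fun x => match x with
  | None => (bits_at A w, a%:Z)
  | Some (inl i) => (@blank A, 0)
  | Some (inr j) => (mark, zmove (shift0 j) + b%:Z * zmove (shiftp j))
  end.
have hI a b : heads (I a b) None = bits_at A w a%:Z by [].
have last_state : set_tape (I (size w) (size w + pad)%N) None (bits_at A w, 0) =
    store w (size w + pad) (fun _ => 0%N) [::].
  apply/funext => -[[i|j]|] //; rewrite /set_tape /=; last first.
    by rewrite /offset big1 ?addr0 // => x _; rewrite mul0r.
  case: eqP => // _; congr pair; apply/funext => -[n|n] //=.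
  by rewrite nth_nil.
rewrite -last_state.
apply: runsW (_ : ((1 + ((size w * (1 + 3) + 3) +
   ((2 * pad + 1) + (4 * size w + 8)).+1).+1).+1 <= _)%N) _; first lia.
apply: (@runs_Then _ _ _ _ _ _ true (I 0%N 0%N)).
  set f := fun r => _; have := runs_Atom f (fun x : X =>
    if x is None then (bits_at A w, 0) else (@blank A, 0)).
  congr runs; apply/funext => -[[i|j]|]; rewrite /zact_all /f /=.
  - by rewrite /heads zact_read addr0.
  - by rewrite /zact /= mul0r add0r addr0.
  - by rewrite /heads zact_read addr0.
apply: (@runs_Then _ _ _ _ _ _ true (I (size w) (size w))).
  apply: (@runs_Loop _ _ _ _ (fun i => I i i)).
  - by move=> i hi; rewrite hI bits_at_None; lia.
  - by rewrite hI bits_at_None; lia.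
  - move=> i hi; set d := fun x => _; have := runs_nudge d (I i i); congr runs.
    apply/funext => -[[k|j]|] //=; congr pair; lia.
apply: (@runs_Then _ _ _ _ _ _ true (I (size w) (size w + pad)%N)).
  move: {2 4}(size w) => b; elim: pad b {last_state} => [|n IH] b.
    have := runs_nudge (fun _ => Stay) (I (size w) b); congr runs.
    by apply/funext => x; rewrite addr0 addn0; case: (I _ _ _).
  apply: runsW (_ : ((1 + (2 * n + 1)).+1 <= _)%N) _; first lia.
  have -> : (b + n.+1 = b.+1 + n)%N by lia.
  apply: (runs_Then (b := true)) (IH b.+1).
  set d := fun x => _; have := runs_nudge d (I (size w) b); congr runs.
  apply/funext => -[[k|j]|] //=; congr pair; lia.
exact: runs_rewind.
Qed.

(** The output must be a bit followed by a blank. Position [-1] of the input tape is blank, so the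
    bit is copied to position [-2]. *)
Definition answer : mach A X :=
  Then (nudge A (one None MoveLeft)) (Then (nudge A (one None MoveLeft))
    (Atom (fun r => (true, fun x =>
       if x is None then (r (Some (inl ord0)), Stay) else (r x, Stay))))).

Lemma runs_answer (T : ztapes A X) w b :
  T None = (bits_at A w, 0) -> heads T (Some (inl ord0)) = Some (inl b) ->
  exists2 T', runs answer T 5 true T' &
    (T' None).1 (T' None).2 = Some (inl b) /\
    (T' None).1 ((T' None).2 + 1) = None.
Proof.
move=> h0 hb.
have r1 := runs_one None MoveLeft T.
set T1 := set_tape _ _ _ in r1.
have r2 := runs_one None MoveLeft T1.
set T2 := set_tape _ _ _ in r2.
have e2 : T2 None = (bits_at A w, -2) by rewrite /T2 /set_tape eqxx /T1 /set_tape eqxx h0.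
have r3 := runs_Atom (fun r => (true, fun x : X =>
       if x is None then (r (Some (inl ord0)), Stay) else (r x, Stay))) T2.
eexists; first exact: (runs_Then r1 (runs_Then r2 r3)).
have hb2 : heads T2 (Some (inl ord0)) = Some (inl b) by exact: hb.
by rewrite /zact_all [(_, _).2 _]/= hb2 e2.
Qed.

End Compile.

(** The length of [w'] is bounded as well, because the running time of [M] will be measured in it.
    Only the first bit of the output of [M] is kept. *)
Theorem preprocess (M : TM) (c : cmd) (pad : nat) :
  wf c -> (0 < pad)%N ->
  exists (M' : TM) (K d : nat), forall (w : seq bool) t b y,
    let w' := out w (size w + pad) c (fun _ => 0%N) in
    (size w' <= K * (size w + pad) ^ d)%N /\
    (outputs_in M w' t (b :: y) ->
     exists2 t', (t' <= K * (size w + pad) ^ d + t)%N &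
       outputs_in M' w t' [:: b]).
Proof.
move=> wc pad0.
have [K [d H]] := cost_poly c.
pose M0 := Then (setup (tm_work M) (tm_tapes M) pad)
  (Then (comp (tm_work M) (tm_tapes M) c)
  (Then (rewind (tm_work M) (Some (inl ord0)))
  (Then (sim M Aux) (answer (tm_work M) (tm_tapes M))))).
exists (tm_of M0), (5 * K + 60)%N, d.+1 => w t b y w'.
have p0 : (0 < size w + pad)%N by lia.
have sw : (size w' <= K * (size w + pad) ^ d)%N.
  by apply: leq_trans (size_out _ _ _ _) _; apply: H.
have pd : (0 < (size w + pad) ^ d)%N by rewrite expn_gt0 p0.
split; first by rewrite expnS; move: sw pd; move: ((size w + pad) ^ d)%N; nia.
move=> hM.
have r1 := runs_setup (tm_work M) (tm_tapes M) pad w.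
have r2 := runs_comp (tm_work M) (tm_tapes M) w (size w + pad)
  (e := fun _ => 0%N) [::] wc (fun _ _ => erefl).
rewrite cat0s -/w' in r2.
have r3 := runs_rewind
  (T := @store (tm_work M) (tm_tapes M) w (size w + pad) (fun _ => 0%N) w')
  (x := Some (inl ord0)) (o := w') erefl.
set T3 := set_tape _ _ _ in r3.
have [i|T4 r4 [e4 _ [l [r [R e]]]]] := runs_sim (Y := Aux) (T := T3) hM.
  rewrite /T3 /set_tape /tm_init /= tnth_mktuple.
  case: (altP (i =P ord0)) => [->|hi]; first by rewrite eqxx; exact: rep_bits.
  have -> /= : (Some (inl i) == Some (inl ord0) :> option ('I_(tm_tapes M).+1 + Aux))
               = false.
    by apply/eqP => -[ei]; rewrite ei eqxx in hi.
  exact: rep_blank.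
have [||T5 r5 [o1 o2]] := @runs_answer (tm_work M) (tm_tapes M) T4 w b.
- by rewrite e4.
- have [_] := R 0%N; rewrite addr0 -/(heads T4 (Some (inl ord0))) => <- /=.
  by case: r e {R} => [|[[r0|]|] r] //= [-> _].
have [t' ht' ho] := tm_of_outputs (runs_Then r1 (runs_Then r2 (runs_Then r3
   (runs_Then r4 r5)))) (w := w) erefl (fun _ => erefl) o1 o2.
exists t' => //; apply: leq_trans ht' _.
have := H _ p0; rewrite expnS; move: sw pd.
have : (size w <= size w + pad)%N by lia.
have : (pad <= size w + pad)%N by lia.
move: (size w + pad)%N p0 (cost _ _) => p p0 k.
move: (p ^ d)%N (size w') => a n hpad hw hn ha hk.
have h1 : (K * a <= K * (p * a))%N by rewrite leq_mul2l leq_pmull ?orbT.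
have h2 : (p <= p * a)%N by rewrite leq_pmulr.
rewrite mulnDl -mulnA; move: (K * a)%N (K * (p * a))%N (p * a)%N h1 h2 hn hk.
by move=> x z u; lia.
Qed.

End Loops.

(** * Deterministic layered networks *)

Section Levels.
Variables (V C : finType) (G : network V C) (tau : C -> {set V}).
Variable lvl : V -> nat.
Hypothesis prob1 : forall u v, prob G u v = 1.
Hypothesis lvl_edge : forall u v, edge G u v -> lvl v = (lvl u).+1.
Hypothesis lvl_pred : forall v, (0 < lvl v)%N -> exists u, edge G u v.
Hypothesis lvl_seed : forall v, ([set c | v \in tau c] == set0) = (0 < lvl v)%N.
Hypothesis lvl_max : forall v, (lvl v <= #|V|)%N.

(** Edges raise the level by one, so the recursion can run on a number; the value is meaningful for
    [n = lvl v]. *)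
Fixpoint final_at (n : nat) (v : V) : C :=
  act G v (if n is n'.+1 then [set (u, final_at n' u) | u in [set u | edge G u v]]
           else [set (v, c) | c in [set c | v \in tau c]]).

Definition final (v : V) : C := final_at (lvl v) v.

Lemma final_seed v : lvl v = 0%N ->
  final v = act G v [set (v, c) | c in [set c | v \in tau c]].
Proof. by rewrite /final => ->. Qed.

Lemma final_edge v : (0 < lvl v)%N ->
  final v = act G v [set (u, final u) | u in [set u | edge G u v]].
Proof.
rewrite {1}/final => hv; case e : (lvl v) hv => [//|n] _ /=.
congr (act G v _); apply: eq_in_imset => u; rewrite inE => /lvl_edge.
by rewrite /final e => -[->].
Qed.

(** An outcome that misses an attempt has a factor [1 - 1], so only the full set of attempts
    contributes. *)
Lemma expectation_det (phi : state V C -> rat) t pi new :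
  expectation G phi t.+1 pi new =
  let pi' := next_state G pi (attempts G pi new) in
  expectation G phi t pi' (active pi' :\: active pi).
Proof.
rewrite /= (bigD1 (attempts G pi new)) //= big1 ?addr0 => [|X /andP[sX nX]].
  by rewrite /outcome_prob big1 ?mul1r // => e ->; rewrite prob1.
have [e eA eX] : exists2 e, e \in attempts G pi new & e \notin X.
  by apply/subsetPn; apply: contra nX => h; rewrite eqEsubset sX.
by rewrite /outcome_prob (bigD1 e) //= (negPf eX) prob1 subrr !mul0r.
Qed.

Let stage (n : nat) : state V C :=
  [ffun v => if (lvl v <= n)%N then Some (final v) else None].

(** All in-neighbours of a node of level [n.+1] have level [n], so they attempt at the same step and
    the node sees all of them at once. *)
Lemma next_stage n :
  next_state G (stage n) (attempts G (stage n) [set v | lvl v == n]) = stage n.+1.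
Proof.
apply/ffunP => v; rewrite !ffunE; case: (leqP (lvl v) n) => h.
  by rewrite ifT //; lia.
have att u : ((u, v) \in attempts G (stage n) [set v | lvl v == n]) =
             (lvl u == n) && edge G u v.
  by rewrite !inE /= ffunE leqNgt h andbT.
case: (eqVneq (lvl v) n.+1) => [e|ne]; last first.
  rewrite ifT; first by rewrite ifF //; lia.
  apply/eqP/setP => u; rewrite in_set0 inE att; apply/negP => /andP[/eqP hu /lvl_edge].
  by rewrite hu => /eqP; rewrite (negPf ne).
rewrite ifF; last first.
  have [u hu] := lvl_pred (v := v) (leq_ltn_trans (leq0n _) h).
  apply/negP => /eqP/setP/(_ u); rewrite in_set0 inE att hu andbT.
  by have := lvl_edge hu; rewrite e => -[->]; rewrite eqxx.
rewrite e leqnn; congr Some; rewrite final_edge ?e //; congr (act G v _).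
apply/setP => -[u c]; rewrite inE att ffunE /=.
apply/andP/imsetP => [[/andP[/eqP <- uv]]|[u' ] ].
  by rewrite leqnn => /eqP[<-]; exists u; rewrite ?inE.
rewrite inE => hu' [-> ->]; rewrite hu'.
by have := lvl_edge hu'; rewrite e => -[->]; rewrite leqnn !eqxx.
Qed.

Lemma active_stage n : active (stage n) = [set v | (lvl v <= n)%N].
Proof. by apply/setP => v; rewrite !inE ffunE; case: ifP. Qed.

Theorem expected_final_levels (phi : state V C -> rat) :
  expected_final G tau phi = phi [ffun v => Some (final v)].
Proof.
(* Steps beyond the last level change nothing, so the number of steps need not match the number of
   levels. *)
have H t n : expectation G phi t (stage n) [set v | lvl v == n] = phi (stage (n + t)%N).
  elim: t n => [|t IH] n; first by rewrite addn0.
  rewrite expectation_det next_stage /= addnS -addSn -IH; congr expectation.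
  by rewrite !active_stage; apply/setP => v; rewrite !inE; lia.
have e0 : init_state G tau = stage 0.
  apply/ffunP => v; rewrite !ffunE /= lvl_seed leqn0; case: posnP => // h.
  by rewrite final_seed.
rewrite /expected_final e0.
have -> : active (stage 0) = [set v | lvl v == 0%N].
  by rewrite active_stage; apply/setP => v; rewrite !inE leqn0.
by rewrite H; congr phi; apply/ffunP => v; rewrite !ffunE lvl_max.
Qed.

End Levels.

(** * Reading a formula *)

Inductive mode :=
| Header
| NextClause
| Finished
| Index of option bool
| Sign of option bool.

Definition mode_code (m : mode) :
    option (option (option (option bool + option bool))) :=
  match m with
  | Header => None
  | NextClause => Some None
  | Finished => Some (Some None)
  | Index j => Some (Some (Some (inl j)))
  | Sign j => Some (Some (Some (inr j)))
  end.

Definition mode_decode (m : option (option (option (option bool + option bool)))) :=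
  match m with
  | None => Header
  | Some None => NextClause
  | Some (Some None) => Finished
  | Some (Some (Some (inl j))) => Index j
  | Some (Some (Some (inr j))) => Sign j
  end.

Lemma mode_codeK : cancel mode_code mode_decode. Proof. by case. Qed.

HB.instance Definition _ := Finite.copy mode (can_type mode_codeK).

(** The reader of a formula: its mode, a bit to be remembered, whether all
    clauses read so far are satisfied, whether the current one is.
    [Index j] and [Sign j] read the index and the sign of the first, second or
    third literal, as [j] is [None], [Some false] or [Some true]. *)
Definition ctrl : finType := (mode * bool * bool * bool)%type.

Definition ctrl0 (z : bool) : ctrl := (Header, z, true, false).

Definition next_ctrl (c : ctrl) (val bit : bool) : ctrl :=
  let: (m, z, ok, cl) := c in
  match m with
  | Header => (if bit then Header else NextClause, z, ok, cl)
  | NextClause => (if bit then Index None else Finished, z, ok, false)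
  | Finished => c
  | Index j => (if bit then Index j else Sign j, z, ok, cl)
  | Sign None => (Index (Some false), z, ok, cl || (val == bit))
  | Sign (Some false) => (Index (Some true), z, ok, cl || (val == bit))
  | Sign (Some true) => (NextClause, z, ok && (cl || (val == bit)), false)
  end.

Definition indexing (c : ctrl) : bool := if c.1.1.1 is Index _ then true else false.

Definition remembered (c : ctrl) : bool := c.1.1.2.

Definition accepting (c : ctrl) : bool := c.1.2.

(** The number is how far the sequence [a] of values has been shifted. *)
Definition scan (a : nat -> bool) (s : ctrl * nat) (bit : bool) : ctrl * nat :=
  (next_ctrl s.1 (a s.2) bit, if indexing s.1 then s.2.+1 else 0%N).

Section Scan.
Variables (a : nat -> bool) (n : nat).

Lemma remembered_scan s bits :
  remembered (foldl (scan a) s bits).1 = remembered s.1.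
Proof.
elim: bits s => //= b bits IH s; rewrite IH.
by case: s => [[[[[| | |j|[[]|]] z] ok] cl] h].
Qed.

(* Leaving [Index] costs one more shift: variable [i] is found at [i.+1]. *)
Lemma scan_literal (i : nat) (b : bool) j z ok cl h :
  foldl (scan a) ((Index j, z, ok, cl), h) (rcons (enc_nat i) b) =
  (next_ctrl (Sign j, z, ok, cl) (a (h + i).+1) b, 0%N).
Proof.
elim: i h => [|i IH] h; first by rewrite addn0.
rewrite [LHS](_ : _ = foldl (scan a) ((Index j, z, ok, cl), h.+1) (rcons (enc_nat i) b)) //.
by rewrite IH addSnnS.
Qed.

Definition true_literal (l : 'I_n * bool) : bool := a l.1.+1 == l.2.

Lemma scan_clause (cl : 3.-tuple ('I_n * bool)) z ok c :
  foldl (scan a) ((NextClause, z, ok, c), 0%N)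
    (true :: flatten [seq rcons (enc_nat l.1) l.2 | l : 'I_n * bool <- cl]) =
  ((NextClause, z, ok && has true_literal cl, false), 0%N).
Proof.
case: cl => -[|l1 [|l2 [|l3 [|? ?]]]] // sz /=.
rewrite cats0 !foldl_cat [scan _ _ _]/= scan_literal /= scan_literal /= scan_literal /=.
by rewrite /true_literal orbF !orbA.
Qed.

Lemma scan_header z :
  foldl (scan a) (ctrl0 z, 0%N) (enc_nat n) =
  ((NextClause, z, true, false), 0%N).
Proof. by rewrite /enc_nat; elim: n => // k IH; rewrite -{}IH. Qed.

Lemma scan_formula (phi : cnf3 n) z :
  foldl (scan a) (ctrl0 z, 0%N) (enc_cnf3 phi) =
  ((Finished, z, all (fun cl : 3.-tuple _ => has true_literal cl) phi, false), 0%N).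
Proof.
rewrite /enc_cnf3 foldl_cat scan_header /enc_seq -cats1 foldl_cat.
(* The initial flag becomes a factor of the conjunction, so that it can be generalised before the
   induction over clauses. *)
rewrite -[X in _ = ((_, _, X, _), _)]andTb.
move: {1 3}true => ok.
elim: phi ok {1}false => [|cl phi IH] ok c; first by rewrite /= andbT.
by rewrite map_cons [flatten _]/= -cat_cons foldl_cat scan_clause IH /= andbA.
Qed.

(** The network runs for [q] steps whatever the length of the formula, so the reader must survive
    the padding. *)
Lemma scan_padding z ok cl k :
  foldl (scan a) ((Finished, z, ok, cl), 0%N) (nseq k false) =
  ((Finished, z, ok, cl), 0%N).
Proof. by elim: k. Qed.

End Scan.

(** * The network of a formula *)

Definition cell : finType := (bool * bool * bool)%type.

(** Cells hold a value, the value shifted there, and the input bit shifted there. *)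
Definition next_cell (c : ctrl) (self right : cell) : cell :=
  (self.1.1, if indexing c then right.1.2 else self.1.1, right.2).

Definition label : finType := (ctrl + cell)%type.

Definition rest : label := inl (ctrl0 false).

(** [Ctrl] is the reader, [Cell] the ring, [New] the row that carries the new cascade, [Block] the
    nodes that make up the gap. A row [Const l] keeps the colour of [l] in every layer, as a supply
    for the activation functions. *)
Inductive kind := Ctrl | New | Cell | Block | Const of label.

Definition kind_code (k : kind) : option (option (option (option label))) :=
  match k with
  | Ctrl => None
  | New => Some None
  | Cell => Some (Some None)
  | Block => Some (Some (Some None))
  | Const q => Some (Some (Some (Some q)))
  end.

Definition kind_decode (k : option (option (option (option label)))) : kind :=
  match k with
  | None => Ctrl
  | Some None => New
  | Some (Some None) => Cell
  | Some (Some (Some None)) => Block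
  | Some (Some (Some (Some q))) => Const q
  end.

Lemma kind_codeK : cancel kind_code kind_decode. Proof. by case. Qed.

HB.instance Definition _ := Finite.copy kind (can_type kind_codeK).

(** An inner node has one in-neighbour per slot. Slots and cascades are fixed in number, so a table
    has a constant number of entries. *)
Inductive slot := FromCtrl | FromNew | FromSelf | FromRight | FromConst of label.

Definition slot_code (k : slot) : option (option (option (option label))) :=
  match k with
  | FromCtrl => None
  | FromNew => Some None
  | FromSelf => Some (Some None)
  | FromRight => Some (Some (Some None))
  | FromConst q => Some (Some (Some (Some q)))
  end.

Definition slot_decode (k : option (option (option (option label)))) : slot :=
  match k with
  | None => FromCtrl
  | Some None => FromNew
  | Some (Some None) => FromSelf
  | Some (Some (Some None)) => FromRight
  | Some (Some (Some (Some q))) => FromConst q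
  end.

Lemma slot_codeK : cancel slot_code slot_decode. Proof. by case. Qed.

HB.instance Definition _ := Finite.copy slot (can_type slot_codeK).

Definition cascade : finType := option 'I_#|label|.

Definition color (q : label) : cascade := Some (enum_rank q).

Definition label_of (c : option cascade) : label :=
  if c is Some (Some i) then enum_val i else rest.

Definition ctrl_of (c : option cascade) : ctrl :=
  if label_of c is inl s then s else ctrl0 false.

Definition cell_of (c : option cascade) : cell :=
  if label_of c is inr s then s else (false, false, false).

Lemma label_of_color q : label_of (Some (color q)) = q.
Proof. exact: enum_rankK. Qed.

Lemma ctrl_of_color c : ctrl_of (Some (color (inl c))) = c.
Proof. by rewrite /ctrl_of label_of_color. Qed.

Lemma cell_of_color c : cell_of (Some (color (inr c))) = c.
Proof. by rewrite /cell_of label_of_color. Qed.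

Definition seed_goal (k : kind) (main bit : bool) (D : {set cascade}) : cascade :=
  let sel := None \in D in
  match k with
  | Ctrl => color (inl (ctrl0 sel))
  | New => if sel && main then None else color rest
  | Cell => color (inr (sel, sel, bit))
  | Block => color rest
  | Const q => color q
  end.

(** A function must be admissible on every input, also when [D] lacks the goal. The fallback never
    takes effect in the instance, where layer [0] is seeded by all existing cascades. *)
Definition seed_act k main bit (D : {set cascade}) : cascade :=
  let g := seed_goal k main bit D in
  if g \in D then g else odflt None [pick c in D].

(** At a [Block], a remembered seed [z] makes everything depend on the verdict; otherwise [lz]
    confines the spread to one face of the cube of blocks. *)
Definition inner_goal (k : kind) (main lz : bool)
    (s : {ffun slot -> option cascade}) : cascade :=
  let c := ctrl_of (s FromCtrl) in
  let x := cell_of (s FromSelf) in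
  match k with
  | Ctrl => color (inl (next_ctrl c x.1.2 x.2))
  | New => if main then odflt None (s FromNew) else color rest
  | Cell => color (inr (next_cell c x (cell_of (s FromRight))))
  | Block => if (s FromNew == Some None) &&
                (if remembered c then accepting c else lz)
             then None else color rest
  | Const q => color q
  end.

Definition inner_act k main lz (s : {ffun slot -> option cascade}) : cascade :=
  let g := inner_goal k main lz s in
  if [exists j, s j == Some g] then g
  else odflt None [pick c | [exists j, s j == Some c]].

Section Instance.
Variables (w : seq bool) (q : nat).
Hypothesis q0 : (0 < q)%N.
Local Notation p := q.+1.

(** The first coordinate of a node is its layer, unless it is a [Block].  The
    second one is the index of a [Cell].  Apart from the [Block]s, nodes whose
    other coordinates are not [0] are mere copies; those in layer [0] serve to
    fill seed sets up. *)
Definition cnode : finType := (kind * ('I_p * ('I_p * 'I_p)))%type.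

Definition vertex : finType := 'I_#|cnode|.

Definition node (v : vertex) : cnode := enum_val v.
Definition vtx (x : cnode) : vertex := enum_rank x.

Lemma vtxK : cancel vtx node. Proof. exact: enum_rankK. Qed.
Lemma nodeK : cancel node vtx. Proof. exact: enum_valK. Qed.

(** All blocks hang off the last layer. For other kinds [ord_pred] wraps around at layer [0], which
    is harmless as only inner nodes receive edges. *)
Definition layer_before (x : cnode) : 'I_p :=
  if x.1 is Block then ord_max else ord_pred x.2.1.

Definition source (j : slot) (x : cnode) : cnode :=
  let t := layer_before x in
  match j with
  | FromCtrl => (Ctrl, (t, (ord0, ord0)))
  | FromNew => (New, (t, (ord0, ord0)))
  | FromSelf => (Cell, (t, (x.2.2.1, ord0)))
  | FromRight => (Cell, (t, (ordS x.2.2.1, ord0)))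
  | FromConst q => (Const q, (t, (ord0, ord0)))
  end.

Definition inner (x : cnode) : bool := (x.1 == Block) || (x.2.1 != ord0).
Definition corner (x : cnode) : bool := (x.2.2.1 == ord0) && (x.2.2.2 == ord0).
Definition front (x : cnode) : bool := x.2.2.2 == ord0.
Definition bit_of (x : cnode) : bool := nth false w x.2.2.1.

(** [FromSelf] and [FromRight] differ because the ring has at least two cells; this is where [q0]
    enters. *)
Lemma source_inj x : injective (source^~ x).
Proof.
have h : ordS x.2.2.1 <> x.2.2.1.
  move=> /(congr1 val) /=; have := ltn_ord x.2.2.1.
  move: (x.2.2.1 : nat) => i; rewrite ltnS => hi; move: hi.
  rewrite leq_eqVlt => /orP[/eqP ->|hi]; first by rewrite modnn; lia.
  by rewrite modn_small; lia.
case=> [||||l] [||||l'] //=; try by case.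
- by case=> e; case: h.
- by case=> ->.
Qed.

Definition nedge (u v : vertex) : bool :=
  inner (node v) && [exists j, node u == source j (node v)].

(** A neighbour input never mentions [v] itself, so the test on first components separates it from
    the seed inputs. *)
Definition nact (v : vertex) (O : {set vertex * cascade}) : cascade :=
  let x := node v in
  if [forall e in O, e.1 == v] then
    seed_act x.1 (corner x) (bit_of x) [set e.2 | e in O]
  else
    inner_act x.1 (corner x) (front x)
      [ffun j => [pick c | (vtx (source j x), c) \in O]].

Lemma nact_seed v (D : {set cascade}) :
  nact v [set (v, c) | c in D] =
  seed_act (node v).1 (corner (node v)) (bit_of (node v)) D.
Proof.
rewrite /nact ifT; last by apply/forall_inP => e /imsetP[c _ ->] /=.
by rewrite -imset_comp (eq_imset (g := fun c => c)) // imset_id.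
Qed.

Lemma nact_input v O : O \in inputs cascade nedge v ->
  nact v O \in [set x.2 | x in O].
Proof.
rewrite !inE /nact => /orP[/andP[/set0Pn[e eO]] h|/and3P[/set0Pn[e eO]] h1 h2].
  rewrite h /seed_act; case: ifP => // _.
  case: pickP => [c //|/(_ e.2)]; by rewrite imset_f.
have /andP[/andP[_ /existsP[j /eqP ej]] nev] := forall_inP h1 e eO.
case: ifP => [/forall_inP/(_ e eO)|_]; first by rewrite (negPf nev).
set s := [ffun j => _].
have sO i c : s i = Some c -> c \in [set x.2 | x in O].
  by rewrite ffunE; case: pickP => // c' h [<-]; apply/imsetP; exists (vtx (source i (node v)), c').
rewrite /inner_act; case: existsP => [[i /eqP/sO] //|_].
case: pickP => [c /existsP[i /eqP/sO] //|].
have: s j <> None.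
  rewrite ffunE; case: pickP => // /(_ e.2).
  by rewrite -ej nodeK; case: (e) eO => ? ? /= ->.
by case e' : (s j) => [c|] // _ /(_ c) /existsP[]; exists j; rewrite e'.
Qed.

Definition net : network vertex cascade :=
  @Network _ _ nedge (fun _ _ => 1) nact (fun _ _ _ => isT) nact_input.

Definition seeds : {set vertex} := [set v | ~~ inner (node v)].

(** A [Const] node takes its colour whether or not it is a seed of the new cascade, so adding
    fillers to a seed set has no side effect. *)
Definition filler (rl : 'I_p * 'I_p) : vertex := vtx (Const rest, (ord0, rl)).

Lemma filler_inj : injective filler.
Proof. by move=> x y /(can_inj vtxK) []. Qed.

Lemma card_filler : #|[set filler rl | rl in [set: 'I_p * 'I_p]]| = (p ^ 2)%N.
Proof. by rewrite (card_imset _ filler_inj) cardsT card_prod !card_ord. Qed.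

Lemma filler_seeds : [set filler rl | rl in [set: 'I_p * 'I_p]] \subset seeds.
Proof. by apply/subsetP => v /imsetP[rl _ ->]; rewrite inE vtxK. Qed.

Lemma seeds_enough : (p ^ 2 <= #|seeds|)%N.
Proof. by rewrite -card_filler; apply: subset_leq_card filler_seeds. Qed.

Lemma label_gt0 : (0 < #|label|)%N.
Proof. by apply/card_gt0P; exists rest. Qed.

(** The budget [p ^ 2] is the number of fillers, and it is at least [p + 2], the most that a
    deliberate choice uses. As every existing cascade seeds all of layer [0], nodes there may take
    any colour. *)
Definition inst : mim :=
  @Mim #|cnode| #|label| net (fun _ => seeds) seeds (p ^ 2)%N
    label_gt0 isT seeds_enough.

Definition lvl (v : vertex) : nat :=
  if (node v).1 is Block then p else (node v).2.1.

Lemma lvl_inner v : (0 < lvl v)%N = inner (node v).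
Proof.
by rewrite /lvl /inner; case: (node v) => [[||||l] [t rl]] //=; rewrite lt0n.
Qed.

Lemma ord_pred_succ (t : 'I_p) : t != ord0 -> t = (ord_pred t).+1 :> nat.
Proof.
clear q0; rewrite -val_eqE /= => t0; have ht := ltn_ord t.
have -> : ((t + p).-1 = t.-1 + p)%N by lia.
by rewrite modnDr modn_small; lia.
Qed.

Lemma lvl_edge u v : nedge u v -> lvl v = (lvl u).+1.
Proof.
move=> /andP[hv /existsP[j /eqP eu]].
have -> : lvl u = layer_before (node v) by rewrite /lvl eu; case: j {eu}.
rewrite -lvl_inner in hv; move: hv; rewrite /lvl /layer_before.
by case: (node v) => [[||||l] [t rl]] //= t0; apply: ord_pred_succ;
   rewrite -val_eqE /= -lt0n.
Qed.

Lemma source_edge x j : inner x -> nedge (vtx (source j x)) (vtx x).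
Proof. by move=> h; rewrite /nedge !vtxK h; apply/existsP; exists j. Qed.

Lemma lvl_pred v : (0 < lvl v)%N -> exists u, nedge u v.
Proof.
rewrite lvl_inner => h; exists (vtx (source FromCtrl (node v))).
by rewrite -{2}(nodeK v) source_edge.
Qed.

Lemma card_kind : (0 < #|{: kind}|)%N.
Proof. by apply/card_gt0P; exists Ctrl. Qed.

Lemma card_cnode : #|cnode| = (#|{: kind}| * p ^ 3)%N.
Proof. by rewrite !card_prod card_ord; congr (_ * _)%N; rewrite !expnS expn0 muln1. Qed.

Lemma lvl_max v : (lvl v <= #|vertex|)%N.
Proof.
rewrite card_ord card_cnode.
have h : (lvl v <= p)%N.
  by rewrite /lvl; case: (node v) => [[||||l] [t rl]] //=; apply: ltnW (ltn_ord t).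
apply: leq_trans h _; rewrite !expnS expn0 muln1.
apply: leq_trans (leq_pmull _ card_kind); apply: leq_pmulr; lia.
Qed.

End Instance.

(** * Its final states *)

Section Dynamics.
Variables (w : seq bool) (q : nat) (S : {set vertex q}).
Hypotheses (q0 : (0 < q)%N) (sS : S \subset seeds q).
Local Notation p := q.+1.
Local Notation tau := (mim_seeds (I := inst w q) S).

Definition fin (x : cnode q) : cascade := final (net w q) tau (@lvl q) (vtx x).

Lemma tau_Some v i : (Some i \in [set c | v \in tau c]) = (v \in seeds q).
Proof. by rewrite inE. Qed.

Lemma tau_None v : (None \in [set c | v \in tau c]) = (v \in S).
Proof. by rewrite inE. Qed.

Lemma tau_lvl v : ([set c | v \in tau c] == set0) = (0 < lvl v)%N.
Proof.
rewrite lvl_inner; apply/eqP/idP => [/setP h|h].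
  have := h (color rest); rewrite tau_Some in_set0 inE => /negbT.
  by rewrite negbK.
have hv : v \notin seeds q by rewrite inE h.
apply/setP => -[i|]; rewrite in_set0 ?tau_Some ?tau_None; first exact: negbTE.
by apply: contraNF hv; apply: (subsetP sS).
Qed.

Lemma mim_value_fin :
  mim_value (I := inst w q) S = #|[set v | fin (node v) == None]|%:R.
Proof.
rewrite /mim_value (@expected_final_levels _ _ _ _ (@lvl q)) //.
- congr (_%:R); apply: eq_card => v; rewrite !inE ffunE /fin nodeK.
  by rewrite (inj_eq Some_inj).
- exact: lvl_edge.
- exact: lvl_pred.
- exact: tau_lvl.
- exact: lvl_max.
Qed.

Lemma fin_seed x : ~~ inner x ->
  fin x = seed_goal x.1 (corner x) (bit_of w x) [set c | vtx x \in tau c].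
Proof.
move=> hx; have xS : vtx x \in seeds q by rewrite inE vtxK.
rewrite /fin final_seed; last first.
  by apply/eqP; rewrite -leqn0 leqNgt lvl_inner vtxK.
rewrite /= nact_seed vtxK.
rewrite /seed_act ifT //; case: x hx xS => k [t rl] hx xS /=.
have C l : color l \in [set c | vtx (k, (t, rl)) \in tau c].
  by rewrite tau_Some.
case: k {hx xS} C => [||||l] C /=; try exact: C.
by case: ifP => [/andP[]|_] //; apply: C.
Qed.

Lemma fin_inner_act x : inner x ->
  fin x = inner_act x.1 (corner x) (front x) [ffun j => Some (fin (source j x))].
Proof.
move=> hx; rewrite {1}/fin (final_edge (G := net w q) _ (@lvl_edge q)) ?lvl_inner ?vtxK //=.
set O := [set _ | _ in _].
have inO j c : ((vtx (source j x), c) \in O) = (c == fin (source j x)).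
  apply/imsetP/eqP => [[u _ [<- ->]] //|->].
  by exists (vtx (source j x)) => //; rewrite inE; apply: source_edge.
rewrite /nact vtxK ifF; last first.
  apply/negP => /forall_inP/(_ (vtx (source FromCtrl x), fin (source FromCtrl x))).
  rewrite inO eqxx => /(_ isT) /= /eqP e.
  by have := lvl_edge (source_edge FromCtrl hx); rewrite e; lia.
congr inner_act; apply/ffunP => j; rewrite !ffunE.
by case: pickP => [c|/(_ (fin (source j x)))]; rewrite inO ?eqxx // => /eqP ->.
Qed.

(** This precedes the general rule for inner nodes, which needs every colour among the
    in-neighbours; a constant row supplies itself through its own slot. *)
Lemma fin_const l (t : 'I_p) : fin (Const l, (t, (ord0, ord0))) = color l.
Proof.
move: {2}(t : nat) (erefl (t : nat)) => n; elim: n t => [|n IH] t ht.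
  by rewrite fin_seed // /inner -val_eqE /= ht.
have ht0 : t != ord0 by rewrite -val_eqE /= ht.
rewrite fin_inner_act /inner_act /=; last by rewrite /inner /= ht0.
rewrite ifT //; apply/existsP; exists (FromConst l); rewrite ffunE /= IH //.
by have := ord_pred_succ ht0; rewrite ht => -[].
Qed.

Lemma fin_inner x : inner x ->
  fin x = inner_goal x.1 (corner x) (front x) [ffun j => Some (fin (source j x))].
Proof.
move=> hx; rewrite fin_inner_act // /inner_act ifT //.
set s := [ffun j => _].
have C l : [exists j, s j == Some (color l)].
  by apply/existsP; exists (FromConst l); rewrite ffunE /= fin_const.
case: x hx @s C => -[||||l] y _ s C //=.
- case: ifP => // _; apply/existsP; exists FromNew; by rewrite !ffunE.
- case: ifP => // /andP[h _]; by apply/existsP; exists FromNew.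
Qed.

Definition remember : bool := vtx (Ctrl, (ord0, (ord0, ord0))) \in S.
Definition source_on : bool := vtx (New, (ord0, (ord0, ord0))) \in S.
(** The index is taken modulo [p] because the values rotate in a ring. *)
Definition assigned (n : nat) : bool :=
  vtx (Cell, (ord0, (inord (n %% p), ord0))) \in S.

Definition scanned (n : nat) : ctrl * nat :=
  foldl (scan assigned) (ctrl0 remember, 0%N) (mkseq (nth false w) n).

(** Layer [t] has read [t] bits, and the last layer has number [q]. *)
Definition accepted : bool := accepting (scanned q).1.

Lemma assigned_mod m n : m = n %[mod p] -> assigned m = assigned n.
Proof. by rewrite /assigned => ->. Qed.

(** Cell [0] shows the reader what it needs next: the value at the current shift and bit number [t].
    As [t < p], the rotation of the bits has not come round yet. *)
Lemma fin_main (t : 'I_p) :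
  fin (Ctrl, (t, (ord0, ord0))) = color (inl (scanned t).1) /\
  forall r : 'I_p, fin (Cell, (t, (r, ord0))) =
    color (inr (assigned r, assigned (r + (scanned t).2), nth false w ((r + t) %% p))).
Proof.
move: {2 3 4 5}(t : nat) (erefl (t : nat)) => n; elim: n t => [|n IH] t ht.
  have t0 : t = ord0 by apply: val_inj.
  split=> [|r]; first by rewrite t0 fin_seed // /= tau_None.
  rewrite t0 fin_seed // /= tau_None /bit_of /= !addn0 modn_small ?ltn_ord //.
  by rewrite /assigned modn_small ?inord_val ?ltn_ord.
have ht0 : t != ord0 by rewrite -val_eqE /= ht.
have hn : ord_pred t = n :> nat by have := ord_pred_succ ht0; rewrite ht => -[].
have [IH1 IH2] := IH _ hn.
have np : (n < p)%N by rewrite -hn ltn_ord.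
have st : scanned n.+1 = scan assigned (scanned n) (nth false w n).
  by rewrite /scanned mkseqS foldl_rcons.
split=> [|r]; rewrite fin_inner /= ?/inner /= ?ht0 //.
  rewrite !ffunE /= IH1 IH2 ctrl_of_color cell_of_color st /=.
  by rewrite !add0n modn_small.
rewrite !ffunE /= IH1 !IH2 ctrl_of_color !cell_of_color st /next_cell /=.
congr (color (inr (_, _, _))); last by rewrite modnDml addSnnS.
(* Outside an index the shift falls back to [0], and the cell restores its own value from its first
   component. *)
case: ifP => _; last by rewrite addn0.
by apply: assigned_mod; rewrite modnDml addSnnS.
Qed.

Lemma fin_New (t : 'I_p) rl :
  fin (New, (t, rl)) =
  if source_on && (rl == (ord0, ord0)) then None else color rest.
Proof.
have -> : (rl == (ord0, ord0)) = corner (New, (t, rl)) by case: rl.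
move: {2}(t : nat) (erefl (t : nat)) => n; elim: n t rl => [|n IH] t rl ht.
  have t0 : t = ord0 by apply: val_inj.
  rewrite t0 fin_seed // /= tau_None /source_on.
  case: (boolP (corner _)) => [|_]; last by rewrite !andbF.
  by case: rl => r l /andP[/eqP/= -> /eqP/= ->]; rewrite !andbT.
have ht0 : t != ord0 by rewrite -val_eqE /= ht.
have hn : ord_pred t = n :> nat by have := ord_pred_succ ht0; rewrite ht => -[].
rewrite fin_inner /= ?/inner /= ?ht0 // ffunE /= IH //.
by case: ifP; rewrite /= ?andbT ?andbF //= => ->.
Qed.

Lemma fin_Block x :
  fin (Block, x) =
  if source_on && (if remember then accepted else x.2.2 == ord0)
  then None else color rest.
Proof.
rewrite fin_inner //= !ffunE /= fin_New eqxx andbT.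
have [-> _] := fin_main ord_max; rewrite ctrl_of_color.
rewrite remembered_scan; congr (if _ && _ then _ else _).
by case: source_on.
Qed.

Lemma fin_None x : fin x == None ->
  (x \in [set (New, (t, (ord0, ord0))) | t in [set: 'I_p]]) ||
  (x.1 == Block) && (if remember then accepted else x.2.2.2 == ord0).
Proof.
case: x => -[||||l] [t rl].
- case: (boolP (inner (Ctrl, (t, rl)))) => h.
    by rewrite fin_inner.
  by rewrite fin_seed.
- rewrite fin_New; case: ifP => // /andP[_ /eqP ->] _.
  by apply/orP; left; apply/imsetP; exists t.
- case: (boolP (inner (Cell, (t, rl)))) => h.
    by rewrite fin_inner.
  by rewrite fin_seed.
- by rewrite fin_Block; case: ifP => // /andP[_ ->]; rewrite orbT.
- case: (boolP (inner (Const l, (t, rl)))) => h.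
    by rewrite fin_inner.
  by rewrite fin_seed.
Qed.

Definition new_count : nat := #|[set v | fin (node v) == None]|.

Lemma new_count_image (X : {set cnode q}) :
  (forall x, x \in X -> fin x == None) -> (#|X| <= new_count)%N.
Proof.
move=> h; rewrite -(card_imset _ (can_inj (@vtxK q))); apply: subset_leq_card.
by apply/subsetP => v /imsetP[x /h hx ->]; rewrite inE vtxK.
Qed.

Lemma image_new_count (X : {set cnode q}) :
  (forall x, fin x == None -> x \in X) -> (new_count <= #|X|)%N.
Proof.
move=> h; rewrite -(card_imset _ (can_inj (@vtxK q))); apply: subset_leq_card.
apply/subsetP => v; rewrite inE => /h hv; apply/imsetP; exists (node v) => //.
by rewrite nodeK.
Qed.

Definition all_blocks : {set cnode q} :=
  [set (Block, x) | x in [set: 'I_p * ('I_p * 'I_p)]].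

Definition front_blocks : {set cnode q} :=
  [set (Block, (x.1, (x.2, ord0))) | x in [set: 'I_p * 'I_p]].

Lemma card_all_blocks : #|all_blocks| = (p ^ 3)%N.
Proof.
rewrite card_imset; last by move=> x y [].
by rewrite cardsT !card_prod card_ord !expnS expn0 muln1.
Qed.

Lemma card_front_blocks : #|front_blocks| = (p ^ 2)%N.
Proof.
rewrite card_imset; last by move=> [x x'] [y y'] [-> ->].
by rewrite cardsT !card_prod card_ord !expnS expn0 muln1.
Qed.

Lemma card_New :
  (#|[set ((New, (t, (ord0, ord0))) : cnode q) | t in [set: 'I_p]]| <= p)%N.
Proof. by apply: leq_trans (leq_imset_card _ _) _; rewrite cardsT card_ord. Qed.

Lemma new_count_accept :
  source_on -> remember -> accepted -> (p ^ 3 <= new_count)%N.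
Proof.
move=> h1 h2 h3; rewrite -card_all_blocks; apply: new_count_image => x.
by move=> /imsetP[y _ ->]; rewrite fin_Block h1 h2 h3.
Qed.

Lemma new_count_forget :
  source_on -> ~~ remember -> (p ^ 2 <= new_count)%N.
Proof.
move=> h1 h2; rewrite -card_front_blocks; apply: new_count_image => x.
by move=> /imsetP[y _ ->]; rewrite fin_Block h1 (negPf h2) /= eqxx.
Qed.

(** Choosing [z] stakes all blocks on the verdict; if it is negative, only the row of [New] nodes
    remains. *)
Lemma new_count_reject :
  remember -> ~~ accepted -> (new_count <= p)%N.
Proof.
move=> h1 h2; apply: leq_trans card_New; apply: image_new_count => x /fin_None.
by rewrite h1 (negPf h2) andbF orbF.
Qed.

Lemma new_count_forget_le : ~~ remember -> (new_count <= p + p ^ 2)%N.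
Proof.
move=> h; rewrite -card_front_blocks.
apply: leq_trans (leq_add card_New (leqnn _)); apply: leq_trans (leq_card_setU _ _).
apply: image_new_count => x /fin_None; rewrite (negPf h) inE.
case/orP => [->//|/andP[/eqP hk /eqP hl]]; apply/orP; right.
apply/imsetP; exists (x.2.1, x.2.2.1) => //.
by case: x hk hl => k [a [b c]] /= -> ->.
Qed.

End Dynamics.

(** * The gap *)

Section Gap.
Variables (n : nat) (phi : cnf3 n) (q : nat).
Local Notation w := (enc_cnf3 phi).
Local Notation p := q.+1.
Hypothesis wq : (size w <= q)%N.

Lemma enc_cnf3_vars : (n.+1 < size w)%N.
Proof.
rewrite /enc_cnf3 /enc_nat /enc_seq size_cat !size_rcons size_nseq.
by clear; lia.
Qed.

Lemma q_gt0 : (0 < q)%N. Proof. have := enc_cnf3_vars; lia. Qed.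

Lemma acceptedE (S : {set vertex q}) :
  accepted w S =
  all (fun cl : 3.-tuple _ => has (@true_literal (assigned S) n) cl) phi.
Proof.
rewrite /accepted /scanned.
have -> : mkseq (nth false w) q = w ++ nseq (q - size w) false.
  apply: (@eq_from_nth _ false); first by rewrite size_mkseq size_cat size_nseq subnKC.
  move=> i; rewrite size_mkseq => hi; rewrite nth_mkseq // nth_cat nth_nseq.
  by case: ltnP => h; rewrite ?if_same // nth_default.
by rewrite foldl_cat scan_formula scan_padding.
Qed.

Lemma accepted_satisfiable (S : {set vertex q}) : accepted w S -> satisfiable phi.
Proof.
rewrite acceptedE => h; apply/existsP; exists [ffun i : 'I_n => assigned S i.+1].
apply: sub_all h => cl; apply: sub_has => l.
by rewrite /true_literal ffunE.
Qed.

Definition chosen (z : bool) (A : pred 'I_p) : {set vertex q} :=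
  vtx (New, (ord0, (ord0, ord0))) |:
  ((if z then [set vtx (Ctrl, (ord0, (ord0, ord0)))] else set0) :|:
   [set vtx (Cell, (ord0, (r, ord0))) | r in A]).

Lemma chosen_extend z A : exists2 S : {set vertex q},
  feasible (I := inst w q) S &
  forall k rl, k != Const rest ->
    (vtx (k, (ord0, rl)) \in S) = (vtx (k, (ord0, rl)) \in chosen z A).
Proof.
pose F := [set filler (q := q) rl | rl in [set: 'I_p * 'I_p]].
have sP : chosen z A \subset seeds q.
  apply/subsetP => v; rewrite !inE => /orP[/eqP ->|/orP[]]; first by rewrite vtxK.
    by case: z; rewrite inE // => /eqP ->; rewrite vtxK.
  by move=> /imsetP[r _ ->]; rewrite vtxK.
have cP : (#|chosen z A| <= p ^ 2)%N.
  apply: leq_trans (_ : 1 + (1 + p) <= _)%N; last first.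
    have := q_gt0; rewrite !expnS expn0; nia.
  apply: leq_trans (leq_card_setU _ _) _; rewrite cards1 leq_add2l.
  apply: leq_trans (leq_card_setU _ _) _; apply: leq_add.
    by case: z {sP}; rewrite ?cards1 ?cards0.
  apply: leq_trans (leq_imset_card _ _) _.
  by rewrite -[X in (_ <= X)%N](card_ord p); apply: max_card.
have dPF : [disjoint chosen z A & F].
  apply/pred0P => v /=; apply/negP => /andP[h /imsetP[rl _ e]].
  move: h; rewrite e !inE => /orP[/eqP/(can_inj (@vtxK q)) //|/orP[]].
    by case: z {sP cP}; rewrite inE // => /eqP/(can_inj (@vtxK q)).
  by move=> /imsetP[r _ /(can_inj (@vtxK q))].
have [s [us ss sF]] : exists s, [/\ uniq s, size s = (p ^ 2 - #|chosen z A|)%N & {subset s <= F}].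
  by apply/card_geqP; rewrite card_filler leq_subr.
exists (chosen z A :|: [set v in s]).
  rewrite /feasible /= subUset sP /=; apply/andP; split.
    apply/subsetP => v; rewrite inE => /sF; apply/subsetP; exact: filler_seeds.
  rewrite cardsU; have -> : chosen z A :&: [set v in s] = set0.
    apply/setP => v; rewrite in_setI in_set0; apply/negP => /andP[h1].
    rewrite inE => /sF h2.
    by have /pred0P/(_ v) := dPF; rewrite /= h1 h2.
  have -> : #|[set v in s]| = size s by rewrite cardsE; apply/card_uniqP.
  by rewrite cards0 subn0 ss subnKC.
move=> k rl hk; rewrite in_setU [X in _ || X]inE.
case: (boolP (_ \in s)) => [/sF/imsetP[rl' _ /(can_inj (@vtxK q))]|]; last by rewrite orbF.
by case=> e; rewrite e eqxx in hk.
Qed.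

Lemma exists_forget : exists2 S : {set vertex q},
  feasible (I := inst w q) S & source_on S && ~~ remember S.
Proof.
have [S fS hS] := chosen_extend false pred0; exists S => //.
rewrite /source_on /remember !hS // !inE eqxx /=.
rewrite negb_or; apply/andP; split; first by apply/eqP => /(can_inj (@vtxK q)).
by apply/negP => /imsetP[].
Qed.

Lemma exists_accept : satisfiable phi -> exists2 S : {set vertex q},
  feasible (I := inst w q) S & [&& source_on S, remember S & accepted w S].
Proof.
move=> /existsP[x hx].
(* Variable [i] goes to cell [i.+1], where the reader finds it after the extra shift on leaving an
   index. This cell exists because the encoding has more than [n.+1] bits. *)
pose A (r : 'I_p) := [exists i : 'I_n, (i.+1 == r :> nat) && x i].
have [S fS hS] := chosen_extend true A; exists S => //.
rewrite /source_on /remember !hS // !inE !eqxx /= orbT /= acceptedE.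
apply: sub_all hx => cl; apply: sub_has => l /eqP hl.
rewrite /true_literal -hl /assigned hS //; apply/eqP.
have hi : (l.1.+1 < p)%N by have := enc_cnf3_vars; have := ltn_ord l.1; lia.
rewrite modn_small // !inE /=.
have -> : (vtx (Cell, (ord0, (inord l.1.+1, ord0))) ==
           vtx (New, (ord0, (ord0, ord0))) :> vertex q) = false.
  by apply/eqP => /(can_inj (@vtxK q)).
have -> : (vtx (Cell, (ord0, (inord l.1.+1, ord0))) ==
           vtx (Ctrl, (ord0, (ord0, ord0))) :> vertex q) = false.
  by apply/eqP => /(can_inj (@vtxK q)).
apply/imsetP/idP => [[r /existsP[i /andP[/eqP hr xi]] /(can_inj (@vtxK q))[]]|xl].
  move=> /(congr1 val); rewrite /= inordK // -hr => -[e].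
  by rewrite (_ : l.1 = i) //; apply: val_inj.
exists (inord l.1.+1) => //; apply/existsP; exists l.1.
by rewrite inordK // eqxx.
Qed.

End Gap.

(** * The program that writes the instance *)

Definition coord : finType := option bool.
Notation cT := (None : coord).
Notation cR := (Some false : coord).
Notation cL := (Some true : coord).

(** Loop variables come in two triples of coordinates, one for a node [x]
    ([false]) and one for a node [y] ([true]). *)
Definition var : finType := (bool * coord)%type.

(** The atoms [x = 0], [x = p], [x = p - 1], [y_i = x_i], [y_T + 1 = x_T] and
    [y_R = x_R + 1]. *)
Inductive atom := Zero of var | End of var | Last of var | Same of coord | Prev | Next.

Definition atom_code (a : atom) : (var + var + var + coord + bool)%type :=
  match a with
  | Zero x => inl (inl (inl (inl x)))
  | End x => inl (inl (inl (inr x)))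
  | Last x => inl (inl (inr x))
  | Same i => inl (inr i)
  | Prev => inr false
  | Next => inr true
  end.

Definition atom_decode (a : (var + var + var + coord + bool)%type) : atom :=
  match a with
  | inl (inl (inl (inl x))) => Zero x
  | inl (inl (inl (inr x))) => End x
  | inl (inl (inr x)) => Last x
  | inl (inr i) => Same i
  | inr false => Prev
  | inr true => Next
  end.

Lemma atom_codeK : cancel atom_code atom_decode. Proof. by case. Qed.

HB.instance Definition _ := Finite.copy atom (can_type atom_codeK).

(** Each atom is the vanishing of a linear form with coefficients [-1], [0], [1]: [Last x] is
    [x - p + 1], [Prev] is [y_T - x_T + 1], [Next] is [y_R - x_R - 1]. *)
Definition atom_coef (a : atom) (v : var) : move :=
  let diff i := if v == (true, i) then MoveRight
                else if v == (false, i) then MoveLeft else Stay in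
  match a with
  | Zero x | End x | Last x => if v == x then MoveRight else Stay
  | Same i => diff i
  | Prev => diff cT
  | Next => diff cR
  end.

Definition atom_shift0 (a : atom) : move :=
  match a with Last _ | Prev => MoveRight | Next => MoveLeft | _ => Stay end.

Definition atom_shiftp (a : atom) : move :=
  match a with End _ | Last _ => MoveLeft | _ => Stay end.

Notation aoffset := (offset atom_coef atom_shift0 atom_shiftp).

Lemma sum_one (e : var -> nat) x :
  \sum_(v : var) (e v)%:Z * zmove (if v == x then MoveRight else Stay) = (e x)%:Z.
Proof.
rewrite (bigD1 x) //= eqxx mulr1 big1 ?addr0 // => v /negPf ->.
by rewrite mulr0.
Qed.

Lemma sum_diff (e : var -> nat) i :
  \sum_(v : var) (e v)%:Z * zmove (if v == (true, i) then MoveRight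
     else if v == (false, i) then MoveLeft else Stay) =
  (e (true, i))%:Z - (e (false, i))%:Z.
Proof.
rewrite (bigD1 (true, i)) //= eqxx mulr1 (bigD1 (false, i)) //= eqxx mulrN1.
rewrite big1 ?addr0 // => v /andP[/negPf -> /negPf ->].
by rewrite mulr0.
Qed.

Lemma offset_Zero x p e : aoffset (Zero x) p e = (e x)%:Z.
Proof. by rewrite /offset /= sum_one mulr0 !add0r. Qed.

Lemma offset_End x p e : aoffset (End x) p e = (e x)%:Z - p%:Z.
Proof. by rewrite /offset /= sum_one; lia. Qed.

Notation aview := (view (false, cR) atom_coef atom_shift0 atom_shiftp).

Section View.
Variables (w : seq bool) (p : nat) (e : var -> nat).

Lemma view_None : aview w p e None = nth false w (e (false, cR)).
Proof. by []. Qed.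

Lemma view_Zero x : aview w p e (Some (Zero x)) = (e x == 0%N).
Proof. by rewrite /view offset_Zero. Qed.

Lemma view_Last x : aview w p e (Some (Last x)) = ((e x).+1 == p).
Proof. by rewrite /view /offset /= sum_one; apply/eqP/eqP; lia. Qed.

Lemma view_Same i : aview w p e (Some (Same i)) = (e (true, i) == e (false, i)).
Proof.
by rewrite /view /offset /= sum_diff; move: (e (true, i)) (e (false, i)) => a b; lia.
Qed.

Lemma view_Prev : aview w p e (Some Prev) = ((e (true, cT)).+1 == e (false, cT)).
Proof.
by rewrite /view /offset /= sum_diff; move: (e (true, _)) (e (false, _)) => a b; lia.
Qed.

Lemma view_Next : aview w p e (Some Next) = (e (true, cR) == (e (false, cR)).+1).
Proof.
by rewrite /view /offset /= sum_diff; move: (e (true, _)) (e (false, _)) => a b; lia.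
Qed.

End View.

Notation prog := (cmd var atom).
Notation aout := (out (false, cR) atom_coef atom_shift0 atom_shiftp).

Definition cats (cs : seq prog) : prog := foldr (@Cat _ _) (Emit _ _ [::]) cs.

Lemma out_cats w p cs e : aout w p (cats cs) e = flatten [seq aout w p c e | c <- cs].
Proof. by elim: cs => //= c cs ->. Qed.

(** Kinds are fixed in number and are unrolled in the program text; only the coordinates, which
    range up to [p], need loop variables. *)
Definition loop (b : bool) (body : kind -> prog) : prog :=
  cats [seq For (b, cT) (For (b, cR) (For (b, cL) (body k))) | k <- enum {: kind}].

Definition load q (b : bool) (x : cnode q) (e : var -> nat) : var -> nat :=
  upd (upd (upd e (b, cT) x.2.1) (b, cR) x.2.2.1) (b, cL) x.2.2.2.

Lemma enum_prod (T1 T2 : finType) :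
  enum {: T1 * T2} = [seq (x, y) | x <- enum T1, y <- enum T2].
Proof. by rewrite [LHS]enumT unlock. Qed.

Lemma flatten_allpairs (T1 T2 : Type) (T3 : Type) (f : T1 * T2 -> seq T3) s t :
  flatten [seq f z | z <- [seq (x, y) | x <- s, y <- t]] =
  flatten [seq flatten [seq f (x, y) | y <- t] | x <- s].
Proof.
elim: s => //= x s IH; rewrite map_cat flatten_cat IH -map_comp; congr (_ ++ _).
Qed.

Lemma flatten_prod (T1 T2 : finType) (T : Type) (f : T1 * T2 -> seq T) :
  flatten [seq f z | z <- enum {: T1 * T2}] =
  flatten [seq flatten [seq f (x, y) | y <- enum T2] | x <- enum T1].
Proof. by rewrite enum_prod flatten_allpairs. Qed.

Lemma flatten_iota (T : Type) (f : nat -> seq T) p :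
  flatten [seq f i | i <- iota 0 p] = flatten [seq f i | i : 'I_p <- enum 'I_p].
Proof. by rewrite -val_enum_ord -map_comp. Qed.

Lemma out_For w p x c e :
  aout w p (For x c) e = flatten [seq aout w p c (upd e x i) | i : 'I_p <- enum 'I_p].
Proof. exact: (flatten_iota (fun i => aout w p c (upd e x i))). Qed.

(** Enumerations of product types are lexicographic, so nested loops meet the nodes in the order of
    [enum]. *)
Lemma out_loop w q b body e :
  aout w q.+1 (loop b body) e =
  flatten [seq aout w q.+1 (body x.1) (load b x e) | x <- enum (cnode q)].
Proof.
rewrite out_cats -map_comp [RHS]flatten_prod; congr flatten.
apply: eq_map => k; rewrite [LHS]out_For [RHS]flatten_prod; congr flatten.
apply: eq_map => t; rewrite [LHS]out_For [RHS]flatten_prod; congr flatten.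
by apply: eq_map => r; rewrite [LHS]out_For.
Qed.

Lemma bound_cats (P : pred var) cs :
  all P (bound (cats cs)) = all (fun c => all P (bound c)) cs.
Proof. by elim: cs => //= c cs IH; rewrite all_cat IH. Qed.

Lemma wf_cats cs : wf (cats cs) = all (@wf _ _) cs.
Proof. by elim: cs => //= c cs ->. Qed.

(** A program that binds only one triple of variables may be nested in a loop over the other. *)
Definition uses (b : bool) (c : prog) := wf c && all (fun v => v.1 == b) (bound c).

Lemma uses_loop b body : (forall k, bound (body k) = [::] /\ wf (body k)) ->
  uses b (loop b body).
Proof.
move=> h; rewrite /uses wf_cats bound_cats !all_map; apply/andP; split;
  by apply/allP => k _; have [h1 h2] := h k;
     rewrite /= h1 ?h2 /= ?inE ?xpair_eqE ?eqxx.
Qed.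

Lemma wf_loop b body : (forall k, uses (~~ b) (body k)) -> wf (loop b body).
Proof.
move=> h; rewrite wf_cats all_map; apply/allP => k _.
have /andP[hw /allP hb] := h k.
have nb i : (b, i) \notin bound (body k).
  by apply/negP => /hb /=; case: (b).
by rewrite /= !inE !negb_or !nb hw !xpair_eqE !eqxx.
Qed.

Section Tests.
Variables (k k' : kind) (u : option atom -> bool).

Definition t_inner : bool := (k == Block) || ~~ u (Some (Zero (false, cT))).

Definition t_front : bool := u (Some (Zero (false, cL))).

Definition t_corner : bool := u (Some (Zero (false, cR))) && t_front.

Definition t_same : bool :=
  [&& k' == k, u (Some (Same cT)), u (Some (Same cR)) & u (Some (Same cL))].

(** The successor of the last cell is cell [0], which [Next] alone does not see. *)
Definition t_source (j : slot) : bool :=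
  let z := u (Some (Zero (true, cR))) in
  [&& if k is Block then u (Some (Last (true, cT))) else u (Some Prev),
      u (Some (Zero (true, cL))) &
      match j with
      | FromCtrl => (k' == Ctrl) && z
      | FromNew => (k' == New) && z
      | FromSelf => (k' == Cell) && u (Some (Same cR))
      | FromRight => (k' == Cell) &&
                     (u (Some Next) || (u (Some (Last (false, cR))) && z))
      | FromConst l => (k' == Const l) && z
      end].

End Tests.

Section Meaning.
Variables (w : seq bool) (q : nat) (x : cnode q) (e : var -> nat).
Local Notation p := q.+1.

Hypotheses (eT : e (false, cT) = x.2.1) (eR : e (false, cR) = x.2.2.1)
           (eL : e (false, cL) = x.2.2.2).

Lemma t_innerE : t_inner x.1 (aview w p e) = inner x.
Proof. by rewrite /t_inner view_Zero eT. Qed.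

Lemma t_frontE : t_front (aview w p e) = front x.
Proof. by rewrite /t_front view_Zero eL. Qed.

Lemma t_cornerE : t_corner (aview w p e) = corner x.
Proof. by rewrite /t_corner t_frontE view_Zero eR. Qed.

Lemma t_bitE : aview w p e None = bit_of w x.
Proof. by rewrite view_None eR. Qed.

Variable y : cnode q.
Hypotheses (fT : e (true, cT) = y.2.1) (fR : e (true, cR) = y.2.2.1)
           (fL : e (true, cL) = y.2.2.2).

Lemma t_sameE : t_same x.1 y.1 (aview w p e) = (y == x).
Proof.
rewrite /t_same !view_Same eT eR eL fT fR fL.
by case: x y => k [t [r l]] [k' [t' [r' l']]] /=; rewrite !xpair_eqE.
Qed.

(** [inner x] excludes layer [0], where [ord_pred] wraps around whereas [Prev] fails. *)
Lemma t_sourceE j : inner x -> t_source x.1 y.1 (aview w p e) j = (y == source j x).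
Proof.
move=> hx; rewrite /t_source !view_Zero !view_Last view_Same view_Prev view_Next.
rewrite eT eR fT fR fL.
have -> : (if x.1 is Block then (y.2.1).+1 == p else (y.2.1).+1 == x.2.1 :> nat) =
          (y.2.1 == layer_before x).
  move: hx; rewrite /inner /layer_before; case: x => k [t rl] /=.
  have H : (k == Block) || (t != ord0) ->
     k != Block -> ((y.2.1).+1 == t :> nat) = (y.2.1 == ord_pred t).
    move=> /orP[->//|/ord_pred_succ -> _]; by rewrite eqSS.
  by case: k H => // [H|H|H|l H] h; apply: H.
have hR : (y.2.2.1 == (x.2.2.1).+1 :> nat) || ((x.2.2.1).+1 == p) && (y.2.2.1 == 0%N :> nat)
    = (y.2.2.1 == ordS x.2.2.1).
  rewrite -val_eqE /=; have := ltn_ord x.2.2.1; have := ltn_ord y.2.2.1.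
  move: (nat_of_ord x.2.2.1) (nat_of_ord y.2.2.1) => a b hb; rewrite ltnS leq_eqVlt.
  case/orP => [/eqP ->|ha].
    by rewrite modnn eqxx /=; case: eqP => // e'; lia.
  by rewrite modn_small // (_ : (a.+1 == p) = false) ?orbF //; lia.
rewrite hR; have F : (y.2.2.1 == x.2.2.1 :> nat) = (y.2.2.1 == x.2.2.1) by [].
rewrite F; have E (a : 'I_p) : (a == ord0) = (a == 0%N :> nat) by [].
case: y => k' [t' [r' l']] /=; rewrite /source /=.
case: j => [||||l]; rewrite /= !xpair_eqE ?E;
  do ![case: eqP => _ //=].
Qed.

End Meaning.

(** * Tables of the activation functions *)

Section Table.
Variables (w : seq bool) (q : nat).
Hypothesis q0 : (0 < q)%N.

(** [s] tells which in-neighbours succeed and their states. As the sources are distinct, this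
    parametrises the neighbour inputs bijectively once [no_slot] is left out. *)
Definition slot_input (v : vertex q) (s : {ffun slot -> option cascade}) :
    {set vertex q * cascade} :=
  [set e | [exists j, (s j == Some e.2) && (e.1 == vtx (source j (node v)))]].

Definition no_slot : {ffun slot -> option cascade} := [ffun => None].

Lemma no_slotP (s : {ffun slot -> option cascade}) :
  reflect (exists j c, s j = Some c) (s != no_slot).
Proof.
apply: (iffP idP) => [h|[j [c e]]].
  case: (pickP (fun j => s j != None)) => [j|h'].
    by case e : (s j) => [c|] // _; exists j, c.
  case/eqP: h; apply/ffunP => j; rewrite ffunE; apply/eqP.
  exact: negbFE (h' j).
by apply/eqP => es; rewrite es ffunE in e.
Qed.

Lemma source_neq (v : vertex q) j : inner (node v) -> vtx (source j (node v)) != v.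
Proof.
move=> h; apply/eqP => e.
by have := lvl_edge (source_edge j h); rewrite nodeK e; lia.
Qed.

Lemma slot_input_slot v s j c :
  ((vtx (source j (node v)), c) \in slot_input v s) = (s j == Some c).
Proof.
rewrite inE; apply/existsP/idP => /= [[i /andP[si /eqP/(can_inj (@vtxK q))]]|h].
  by move=> /(source_inj q0) ->.
by exists j; rewrite h eqxx.
Qed.

Lemma slot_input_inj v : injective (slot_input v).
Proof.
move=> s s' e; apply/ffunP => j.
have H c : (s j == Some c) = (s' j == Some c) by rewrite -!(slot_input_slot v) e.
case e1 : (s j) H => [c|] H; first by have := H c; rewrite eqxx => /esym/eqP ->.
by case e2 : (s' j) H => [c|] // /(_ c); rewrite eqxx.
Qed.

Lemma nact_slot v s : inner (node v) -> s != no_slot ->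
  nact w v (slot_input v s) =
  inner_act (node v).1 (corner (node v)) (front (node v)) s.
Proof.
move=> hv /no_slotP[j [c e]]; rewrite /nact ifF; last first.
  apply/negP => /forall_inP/(_ (vtx (source j (node v)), c)).
  by rewrite slot_input_slot e eqxx (negPf (source_neq j hv)) => /(_ isT).
congr inner_act; apply/ffunP => i; rewrite ffunE.
case: pickP => [d|h]; first by rewrite slot_input_slot => /eqP ->.
by case ei : (s i) => [d|] //; have := h d; rewrite slot_input_slot ei eqxx.
Qed.

Lemma slot_inputK v (O : {set vertex q * cascade}) :
  O \in neighbour_inputs cascade (@nedge q) v ->
  slot_input v [ffun j => [pick c | (vtx (source j (node v)), c) \in O]] = O.
Proof.
rewrite inE => /and3P[_ h1 h2]; apply/setP => -[u c]; rewrite inE /=.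
apply/existsP/idP => [[j /andP[]]|hO].
  by rewrite ffunE; case: pickP => // d hd /eqP[<-] /eqP ->.
have /andP[/andP[_ /existsP[j /eqP ej]] _] := forall_inP h1 _ hO.
have eu : u = vtx (source j (node v)) by rewrite -ej nodeK.
exists j; rewrite eu eqxx andbT ffunE -eu; case: pickP => [d hd|/(_ c)]; last by rewrite hO.
have := forall_inP (forall_inP h2 _ hO) _ hd.
by rewrite /= eqxx eq_sym /= => /eqP ->.
Qed.

(** Any order of the entries is a legal encoding; this is the order in which the program prints
    them. *)
Definition table_dom (v : vertex q) : seq {set vertex q * cascade} :=
  [seq [set (v, c) | c in D] | D : {set cascade} <- enum {set cascade} & D != set0] ++
  (if inner (node v) then
     [seq slot_input v s | s <- enum {ffun slot -> option cascade} & s != no_slot]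
   else [::]).

Lemma table_dom_perm v :
  perm_eq (table_dom v) (enum (inputs cascade (edge (net w q)) v)).
Proof.
have inj : injective (fun D : {set cascade} => [set (v, c) | c in D]).
  by apply: imset_inj => c c' [].
apply: uniq_perm; last 1 first.
- move=> O; rewrite mem_enum in_setU /table_dom mem_cat; congr (_ || _).
    rewrite inE; apply/mapP/andP => [[D]|[O0 /forall_inP h]].
      rewrite mem_filter => /andP[/set0Pn[c hc] _ ->]; split.
        by apply/set0Pn; exists (v, c); apply: imset_f.
      by apply/forall_inP => e /imsetP[d _ ->].
    exists [set e.2 | e in O].
      rewrite mem_filter mem_enum andbT; case/set0Pn: O0 => e eO.
      by apply/set0Pn; exists e.2; apply: imset_f.
    rewrite -imset_comp -[LHS]imset_id; apply: eq_in_imset => e /h /eqP <-.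
    by case: e.
  case: ifP => hv; last first.
    rewrite in_nil; apply/esym/negP; rewrite inE => /and3P[/set0Pn[e eO] h _].
    by have := forall_inP h _ eO; rewrite /= /nedge hv.
  apply/mapP/idP => [[s]|hO].
    rewrite mem_filter => /andP[/no_slotP[j [c e]] _ ->]; rewrite inE; apply/and3P; split.
    + by apply/set0Pn; exists (vtx (source j (node v)), c); rewrite slot_input_slot e.
    + apply/forall_inP => -[u d]; rewrite inE => /existsP[i /andP[_ /eqP /= ->]].
      by rewrite source_neq // andbT -{2}(nodeK v) source_edge.
    + apply/forall_inP => -[u d]; rewrite inE => /existsP[i /andP[/eqP si /eqP /= ->]].
      apply/forall_inP => -[u' d']; rewrite inE => /existsP[i' /andP[/eqP si' /eqP /= ->]].
      apply/implyP => /eqP/(can_inj (@vtxK q))/(source_inj q0) ei.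
      by move: si'; rewrite -ei si => -[->].
  exists [ffun j => [pick c | (vtx (source j (node v)), c) \in O]]; last by rewrite slot_inputK.
  rewrite mem_filter mem_enum andbT; apply: contraL hO => /eqP e.
  rewrite inE; apply/negP => /and3P[/set0Pn[[u c] eO] h1 _].
  have /andP[/andP[_ /existsP[j /eqP ej]] _] := forall_inP h1 _ eO.
  have := congr1 (fun s : {ffun slot -> option cascade} => s j) e; rewrite !ffunE.
  by case: pickP => // /(_ c); rewrite -ej nodeK eO.
- rewrite /table_dom cat_uniq map_inj_uniq // filter_uniq ?enum_uniq //=.
  case: ifP => hv //; rewrite map_inj_uniq ?filter_uniq -?enumT ?enum_uniq ?andbT //;
    last exact: slot_input_inj.
  (* A neighbour input contains a node other than [v], so it is not a seed input. *)
  apply/hasPn => O /mapP[s]; rewrite mem_filter => /andP[/no_slotP[j [c e]] _ ->].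
  apply/mapP => -[D _ eD].
  have := slot_input_slot v s j c; rewrite e eqxx eD => /imsetP[d _ [ev _]].
  by have := source_neq j hv; rewrite ev eqxx.
- exact: enum_uniq.
Qed.

End Table.

Definition put_bit (f : (option atom -> bool) -> bool) : prog :=
  IfC f (Emit _ _ [:: true]) (Emit _ _ [:: false]).

Definition branch (f : (option atom -> bool) -> bool) (c : bool -> prog) : prog :=
  IfC f (c true) (c false).

Definition put_set (f : kind -> cascade -> (option atom -> bool) -> bool) : prog :=
  loop true (fun k' => cats [seq put_bit (f k' c) | c <- enum cascade]).

(** [D] is a constant of the program, while the corner test and the input bit are known at run time
    only; [branch] selects among precomputed cascades. *)
Definition seed_entry (k : kind) (D : {set cascade}) : prog :=
  Cat (Emit _ _ [:: true])
  (Cat (put_set (fun k' c u => t_same k k' u && (c \in D)))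
       (branch t_corner (fun m => branch (fun u => u None) (fun b =>
          Emit _ _ (enc_cascade (seed_act k m b D)))))).

Definition slot_entry (k : kind) (s : {ffun slot -> option cascade}) : prog :=
  Cat (Emit _ _ [:: true])
  (Cat (put_set (fun k' c u => [exists j, (s j == Some c) && t_source k k' u j]))
       (branch t_corner (fun m => branch t_front (fun f =>
          Emit _ _ (enc_cascade (inner_act k m f s)))))).

Definition put_table (k : kind) : prog :=
  Cat (cats [seq seed_entry k D | D : {set cascade} <- enum {set cascade} & D != set0])
  (Cat (IfC (t_inner k)
         (cats [seq slot_entry k s
               | s <- enum {ffun slot -> option cascade} & s != no_slot])
         (Emit _ _ [::]))
       (Emit _ _ [:: false])).

(** [k'] is the kind of the tail [y] and [k] that of the head [x]. Pairs are enumerated by their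
    first component, so [y] is the outer loop in [generator]. *)
Definition put_edge (k k' : kind) : prog :=
  IfC (fun u => t_inner k u && [exists j, t_source k k' u j])
    (Emit _ _ (true :: enc_prob 1)) (Emit _ _ [:: false]).

Definition put_seeds : prog := loop false (fun k => put_bit (fun u => ~~ t_inner k u)).

Definition put_square : prog := For (false, cT) (For (false, cR) (Emit _ _ [:: true])).

Definition generator : prog := cats
  [:: loop false (fun _ => Emit _ _ [:: true]); Emit _ _ [:: false];
      Emit _ _ (enc_nat #|label|);
      loop true (fun k' => loop false (fun k => put_edge k k'));
      cats [seq put_seeds | _ <- enum 'I_#|label|];
      put_seeds;
      put_square; Emit _ _ [:: false];
      loop false put_table].

Lemma uses_cats b cs : uses b (cats cs) = all (uses b) cs.
Proof.
rewrite /uses wf_cats bound_cats; elim: cs => //= c cs <-.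
by rewrite -!andbA; congr (_ && _); rewrite andbCA.
Qed.

Lemma bound_put_bits (T : Type) f (s : seq T) :
  bound (cats [seq put_bit (f c) | c <- s]) = [::] /\
  wf (cats [seq put_bit (f c) | c <- s]).
Proof. by elim: s => //= c s [-> ->]. Qed.

Lemma uses_put_set f : uses true (put_set f).
Proof. by apply: uses_loop => k; apply: bound_put_bits. Qed.

Lemma uses_entry b s f g (c : bool -> bool -> seq bool) :
  uses b s -> uses b (Cat (Emit _ _ [:: true])
    (Cat s (branch f (fun m => branch g (fun n => Emit _ _ (c m n)))))).
Proof. by move=> /andP[h1 h2]; rewrite /uses /= h1 cats0. Qed.

Lemma uses_put_table k : uses true (put_table k).
Proof.
have h1 : uses true (cats [seq seed_entry k D
   | D : {set cascade} <- enum {set cascade} & D != set0]).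
  rewrite uses_cats all_map; apply/allP => D _ /=.
  exact/uses_entry/uses_put_set.
have h2 : uses true (cats [seq slot_entry k s
               | s <- enum {ffun slot -> option cascade} & s != no_slot]).
  rewrite uses_cats all_map; apply/allP => s _ /=.
  exact/uses_entry/uses_put_set.
move: h1 h2; rewrite /put_table; set c1 := cats _; set c2 := cats _.
rewrite /uses /= => /andP[-> h1] /andP[-> h2].
by rewrite /= !all_cat h1 h2.
Qed.

Lemma wf_generator : wf generator.
Proof.
have hs : wf put_seeds by apply: wf_loop => k.
rewrite wf_cats /= hs /= andbT; apply/and4P; split.
- by apply: wf_loop => k.
- by apply: wf_loop => k; apply: uses_loop => k'.
- by rewrite wf_cats all_map; apply/allP => i _.
- by apply: wf_loop => k; apply: uses_put_table.
Qed.

Lemma map_enum_val (T : finType) : [seq enum_val i | i <- enum 'I_#|T|] = enum T.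
Proof.
case: (pickP (mem T)) => [x0 _|T0]; last first.
  have T0' : #|T| = 0%N by apply: eq_card0.
  have -> : enum T = [::] by apply: size0nil; rewrite -cardE.
  by apply: size0nil; rewrite size_map -cardE card_ord.
have sz : size [seq enum_val i | i <- enum 'I_#|T|] = #|T|.
  by rewrite size_map -cardE card_ord.
apply: (@eq_from_nth _ x0) => [|i]; first by rewrite -cardE.
rewrite sz => hi; rewrite (nth_map (Ordinal hi)) -?cardE ?card_ord //.
by rewrite (enum_val_nth x0) nth_enum_ord.
Qed.

(** * The program prints an encoding of the instance *)

Section Output.
Variables (w : seq bool) (q : nat).
Hypothesis q0 : (0 < q)%N.
Local Notation p := q.+1.
Local Notation outp := (aout w p).

Lemma enum_vertex : enum 'I_#|cnode q| = [seq vtx x | x <- enum (cnode q)].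
Proof.
rewrite -(map_enum_val (cnode q)) -map_comp (eq_map (g := id)) ?map_id // => v.
exact: nodeK.
Qed.

Lemma flatten_vertex (T : Type) (f : vertex q -> seq T) :
  flatten [seq f v | v <- enum 'I_#|cnode q|] =
  flatten [seq f (vtx x) | x <- enum (cnode q)].
Proof. by rewrite enum_vertex -map_comp. Qed.

Lemma enc_set_vertex (O : {set vertex q}) :
  enc_set O = flatten [seq [:: vtx x \in O] | x <- enum (cnode q)].
Proof. by rewrite -(flatten_vertex (fun v => [:: v \in O])) flatten_map1. Qed.

Lemma enc_set_pair (O : {set vertex q * cascade}) :
  enc_set O = flatten [seq flatten [seq [:: (vtx y, c) \in O] | c <- enum cascade]
                      | y <- enum (cnode q)].
Proof.
rewrite /enc_set -[LHS]flatten_map1 flatten_prod.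
exact: (flatten_vertex (fun v => flatten [seq [:: (v, c) \in O] | c <- enum cascade])).
Qed.

Lemma flatten_nseq (T : finType) :
  flatten [seq [:: true] | _ <- enum T] = nseq #|T| true.
Proof. by rewrite cardE; elim: (enum T) => //= x s ->. Qed.

Lemma out_put_bit f e : outp (put_bit f) e = [:: f (aview w p e)].
Proof. by rewrite /=; case: ifP. Qed.

Lemma out_branch f c e : outp (branch f c) e = outp (c (f (aview w p e))) e.
Proof. by rewrite /=; case: (f _). Qed.

Lemma out_Cat c1 c2 e : outp (Cat c1 c2) e = outp c1 e ++ outp c2 e.
Proof. by []. Qed.

Lemma out_IfC f c1 c2 e :
  outp (IfC f c1 c2) e = if f (aview w p e) then outp c1 e else outp c2 e.
Proof. by []. Qed.

Lemma out_put_seeds e : outp put_seeds e = enc_set (seeds q).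
Proof.
rewrite out_loop enc_set_vertex; congr flatten; apply: eq_map => x.
by rewrite out_put_bit (t_innerE _ (x := x)) // inE vtxK.
Qed.

Lemma out_put_edge e (x y : cnode q) :
  outp (put_edge x.1 y.1) (load false x (load true y e)) =
  (if edge (net w q) (vtx y) (vtx x)
   then true :: enc_prob (prob (net w q) (vtx y) (vtx x))
   else [:: false]).
Proof.
rewrite /= (t_innerE _ (x := x)) // /nedge !vtxK.
case: (boolP (inner x)) => //= hx.
congr (if _ then _ else _); apply: eq_existsb => j.
by rewrite (@t_sourceE _ _ x _ _ _ _ y).
Qed.

Lemma out_put_set f (O : {set vertex q * cascade}) e :
  (forall (y : cnode q) c, f y.1 c (aview w p (load true y e)) = ((vtx y, c) \in O)) ->
  outp (put_set f) e = enc_set O.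
Proof.
move=> h; rewrite out_loop enc_set_pair; congr flatten; apply: eq_map => y.
rewrite out_cats -map_comp; congr flatten; apply: eq_map => c.
by rewrite [LHS]out_put_bit h.
Qed.

Lemma out_seed_entry e (x : cnode q) D :
  outp (seed_entry x.1 D) (load false x e) =
  true :: (enc_set [set (vtx x, c) | c in D] ++
           enc_cascade (act (net w q) (vtx x) [set (vtx x, c) | c in D])).
Proof.
rewrite [act _ _ _]nact_seed vtxK /seed_entry.
rewrite out_Cat [in LHS]out_Cat -cat1s; congr (_ ++ (_ ++ _)).
  apply: out_put_set => y c; rewrite (@t_sameE _ _ x _ _ _ _ y) //.
  apply/andP/imsetP => [[/eqP -> hc]|[c' hc [/(can_inj (@vtxK q)) -> ->]]].
    by exists c.
  by rewrite eqxx.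
by rewrite !out_branch (t_cornerE _ (x := x)) // (t_bitE _ (x := x)).
Qed.

Lemma out_slot_entry e (x : cnode q) s : inner x -> s != no_slot ->
  outp (slot_entry x.1 s) (load false x e) =
  true :: (enc_set (slot_input (vtx x) s) ++
           enc_cascade (act (net w q) (vtx x) (slot_input (vtx x) s))).
Proof.
move=> hx hs; rewrite [act _ _ _]nact_slot ?vtxK // /slot_entry.
rewrite out_Cat [in LHS]out_Cat -cat1s; congr (_ ++ (_ ++ _)).
  apply: out_put_set => y c; rewrite inE vtxK; apply: eq_existsb => j.
  by rewrite (@t_sourceE _ _ x _ _ _ _ y) // (inj_eq (can_inj (@vtxK q))).
by rewrite !out_branch (t_cornerE _ (x := x)) // (t_frontE _ (x := x)).
Qed.

Lemma out_put_table e (x : cnode q) :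
  outp (put_table x.1) (load false x e) =
  enc_seq (fun O => enc_set O ++ enc_cascade (act (net w q) (vtx x) O))
    (table_dom (vtx x)).
Proof.
rewrite /enc_seq /table_dom map_cat flatten_cat -cats1 -catA.
rewrite out_Cat [in LHS]out_Cat; congr (_ ++ (_ ++ _)).
  rewrite out_cats -!map_comp; congr flatten; apply: eq_map => D.
  exact: out_seed_entry.
rewrite out_IfC (t_innerE _ (x := x)) // vtxK; case: ifP => // hx.
rewrite out_cats -!map_comp; congr flatten; apply/eq_in_map => s.
by rewrite mem_filter => /andP[hs _]; apply: out_slot_entry.
Qed.

Lemma out_cats_cons c cs e : outp (cats (c :: cs)) e = outp c e ++ outp (cats cs) e.
Proof. by []. Qed.

Lemma out_put_square e : outp put_square e = nseq (p ^ 2) true.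
Proof.
rewrite [LHS](_ : _ = nseq #|{: 'I_p * 'I_p}| true).
  by rewrite card_prod !card_ord expnS expn1.
rewrite -flatten_nseq flatten_prod /put_square out_For; congr flatten.
by apply: eq_map => t; rewrite out_For.
Qed.

Lemma out_generator :
  outp generator (fun _ => 0%N) = enc_mim (I := inst w q) (@table_dom q).
Proof.
rewrite /generator !out_cats_cons [outp (cats [::]) _]/= cats0 /enc_mim /enc_nat.
rewrite out_put_square -!cats1 -!catA.
congr (_ ++ (_ ++ (_ ++ (_ ++ (_ ++ (_ ++ (_ ++ (_ ++ (_ ++ _))))))))).
- by rewrite out_loop flatten_nseq.
- rewrite out_loop [RHS]flatten_prod.
  rewrite [RHS](flatten_vertex (fun u => flatten [seq _ | v <- _])).
  congr flatten; apply: eq_map => y; rewrite out_loop.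
  rewrite [RHS](flatten_vertex (fun v => if nedge (vtx y) v then _ else _)).
  by congr flatten; apply: eq_map => x; rewrite out_put_edge.
- rewrite out_cats -map_comp; congr flatten; apply: eq_map => i.
  exact: out_put_seeds.
- exact: out_put_seeds.
- rewrite out_loop.
  rewrite [RHS](flatten_vertex (fun v =>
    enc_seq (fun O => enc_set O ++ enc_cascade (act (net w q) v O)) (table_dom v))).
  by congr flatten; apply: eq_map => x; rewrite out_put_table.
Qed.

Theorem encodes_generator : encodes_mim (inst w q) (outp generator (fun _ => 0%N)).
Proof.
rewrite out_generator; exists (@table_dom q) => // v.
exact: table_dom_perm.
Qed.

End Output.

(** * The theorem *)

Section Ratio.
Variable R : realType.

Lemma expR_half_le2 : expR (2^-1 : R) <= 2.
Proof.
have h := expR_ge1Dx (- 2^-1 : R); rewrite expRN in h.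
have e0 := expR_gt0 (2^-1 : R).
rewrite -[leLHS]invrK -[leRHS]invrK lef_pV2 ?posrE ?invr_gt0 //.
by apply: le_trans h; lra.
Qed.

Lemma expR_half_nat (n : nat) : expR (n%:R * 2^-1 : R) <= 2 ^+ n.
Proof.
by rewrite expRM_natl lerXn2r ?nnegrE ?expR_ge0 ?expR_half_le2.
Qed.

(** Since [expR (1/2) <= 2], powers of two suffice to bound logarithms from below. *)
Lemma ln_ge (n : nat) (x : R) : 2 ^+ n <= x -> n%:R * 2^-1 <= ln x.
Proof.
move=> h; have h' := le_trans (expR_half_nat n) h.
rewrite -[leLHS]expRK ler_ln ?posrE ?expR_gt0 //.
exact: lt_le_trans (expR_gt0 _) h'.
Qed.

(** [2 ^ 32] gives a logarithm of at least [16 = 2 ^ 4], and this one of at least [2]. *)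
Lemma lnln_ge2 (N : nat) : (2 ^ 32 <= N)%N -> 2 <= ln (ln N%:R : R).
Proof.
move=> hN.
have h : 32%:R * 2^-1 <= ln N%:R :> R by apply: ln_ge; rewrite -natrX ler_nat.
clear hN; have -> : 2 = 4%:R * 2^-1 :> R by lra.
by apply: ln_ge; apply: le_trans h; rewrite -natrX; lra.
Qed.

(** The exponent is at most [1/8], so the eighth power of the ratio is at most [N <= p ^ 4].
    Doubling the ratio contributes [2 ^ 8 = 256], and [256 * p ^ 4 < p ^ 8]. *)
Lemma loglog_ratio_small (p N : nat) :
  (2 ^ 11 <= p)%N -> (p ^ 3 <= N <= p ^ 4)%N ->
  loglog_ratio 3%:R N *+ 2 < p%:R :> R.
Proof.
move=> hp /andP[N1 N2].
have p4 : (4 < p)%N by apply: leq_trans hp.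
(* The cube of [2 ^ 11] is [2 ^ 33], which explains the threshold on [p]. *)
have hN : (2 ^ 32 <= N)%N.
  apply: leq_trans N1; apply: leq_trans (_ : (2 ^ 11) ^ 3 <= _)%N.
    by rewrite -expnM leq_exp2l.
  by rewrite leq_exp2r.
have L2 := lnln_ge2 hN; rewrite /loglog_ratio.
set L := ln _ in L2 *; set a := powR _ _.
have L0 : 0 <= L by apply: le_trans L2.
have N1' : 1 <= N%:R :> R by rewrite ler1n; apply: leq_trans hN; rewrite expn_gt0.
have a0 : 0 <= a by apply: powR_ge0.
have a8 : a ^+ 8 <= (p ^ 4)%:R.
  apply: le_trans (_ : N%:R <= _); last by rewrite ler_nat.
  rewrite -powR_mulrn // /a -powRrM -[leRHS]powRr1 ?ler0n //.
  apply: ler_powR => //; rewrite powR_mulrn //.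
  have L3 : 8 <= L ^+ 3.
    have -> : 8 = 2 ^+ 3 :> R by rewrite -natrX.
    by rewrite lerXn2r ?nnegrE.
  by rewrite mulrC ler_pdivrMr ?mul1r //; apply: lt_le_trans L3.
rewrite ltNge; apply/negP => h.
have h8 : (p ^ 8)%:R <= (a *+ 2) ^+ 8 by rewrite natrX lerXn2r ?nnegrE ?mulrn_wge0.
have : (p ^ 8)%:R <= (256 * p ^ 4)%:R :> R.
  apply: le_trans h8 _; rewrite -mulr_natl exprMn -natrX natrM.
  by apply: ler_pM => //; rewrite ?ler0n ?exprn_ge0.
rewrite ler_nat (expnD p 4 4) leq_pmul2r; last by rewrite expn_gt0 (ltn_trans _ p4).
apply/negP; rewrite -ltnNge; apply: (@leq_trans (5 ^ 4)) => //.
by rewrite leq_exp2r.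
Qed.

End Ratio.

(** The bit of [z] has to come first in the output, where the machine reads it. It does because
    [Ctrl] is coded by [None], which opens the enumeration of an option type. *)
Lemma enum_kind : exists s, enum {: kind} = Ctrl :: s.
Proof.
have dK : injective kind_decode.
  by apply: (can_inj (g := kind_code)) => -[[[[l|]|]|]|].
have h (T : finType) (s : seq T) (f : T -> kind) :
    pmap (fun y => Some (f y)) s = [seq f y | y <- s].
  by elim: s => //= x s ->.
rewrite [enum {: kind}]enumT unlock /= h undup_id; last first.
  by rewrite map_inj_uniq // -enumT enum_uniq.
by rewrite unlock; eexists.
Qed.

Lemma enc_set_remember (q : nat) (S : {set vertex q}) :
  exists y, enc_set S = remember S :: y.
Proof.
rewrite enc_set_vertex; have [s es] := enum_kind.
have : exists s', enum (cnode q) = (Ctrl, (ord0, (ord0, ord0))) :: s'.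
  rewrite enum_prod es enum_prod [enum {: 'I_q.+1 * 'I_q.+1}]enum_prod !enum_ordSl /=.
  by eexists.
by case=> s' -> /=; eexists.
Qed.

Lemma remember_satisfiable (R : realType) n (phi : cnf3 n) q (S : {set vertex q}) :
  let I := inst (enc_cnf3 phi) q in
  (size (enc_cnf3 phi) <= q)%N -> (#|{: kind}| <= q)%N -> (2 ^ 11 <= q)%N ->
  feasible (I := I) S ->
  (forall S', feasible (I := I) S' -> ratr (mim_value (I := I) S') <=
     loglog_ratio 3%:R #|cnode q| * ratr (mim_value (I := I) S) :> R) ->
  remember S = satisfiable phi.
Proof.
move=> I sq kq hq fS h; have q0 := q_gt0 sq.
have sub S0 : feasible (I := I) S0 -> S0 \subset seeds q by case/andP.
have value S0 : feasible (I := I) S0 ->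
    ratr (mim_value (I := I) S0) = (new_count (enc_cnf3 phi) S0)%:R :> R.
  by move=> /sub sS0; rewrite mim_value_fin //; apply: ratr_nat.
have small : loglog_ratio 3%:R #|cnode q| *+ 2 < q.+1%:R :> R.
  apply: loglog_ratio_small; first exact: leqW.
  rewrite card_cnode leq_pmull ?card_kind //= [X in (_ <= X)%N]expnS leq_mul2r.
  by rewrite (leqW kq) orbT.
clear hq; set a := loglog_ratio _ _ in small h.
have a0 : 0 <= a by apply: powR_ge0.
(* A set of value at least [m'] forces [m' <= a * m], against [2 * a < p] and [p * m <= 2 * m']. *)
have gap S' m m' : feasible (I := I) S' -> (m' <= new_count (enc_cnf3 phi) S')%N ->
    (new_count (enc_cnf3 phi) S <= m)%N -> (0 < m)%N -> (q.+1 * m <= 2 * m')%N -> False.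
  move=> fS' h1 h2 m0 h3; have h5 : m'%:R <= a * m%:R.
    apply: le_trans (_ : _ <= ratr (mim_value (I := I) S')) _.
      by rewrite value // ler_nat.
    apply: le_trans (h S' fS') _; apply: ler_wpM2l => //.
    by rewrite value // ler_nat.
  have h6 : (a *+ 2) * m%:R < q.+1%:R * m%:R by rewrite ltr_pM2r ?ltr0n.
  have h7 : q.+1%:R * m%:R <= 2 * m'%:R :> R by rewrite -!natrM ler_nat.
  have := lt_le_trans h6 h7.
  have -> : a *+ 2 * m%:R = 2 * (a * m%:R) by rewrite [LHS]mulrnAl mulr_natl.
  by rewrite ltr_pM2l ?ltr0n // ltNge h5.
case: (boolP (satisfiable phi)) => sat.
  apply/negPn/negP => nr.
  have [S' fS' /and3P[h1 h2 h3]] := exists_accept sq sat.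
  apply: (gap S' (q.+1 + q.+1 ^ 2)%N (q.+1 ^ 3)%N) => //.
  - exact: new_count_accept (sub _ fS') _ _ _.
  - exact: new_count_forget_le (sub _ fS) _.
  - by clear; rewrite !expnS expn0; nia.
apply/negbTE/negP => r.
have [S' fS' /andP[h1 h2]] := exists_forget sq.
apply: (gap S' q.+1 (q.+1 ^ 2)%N) => //.
- exact: new_count_forget (sub _ fS') _ _.
- apply: new_count_reject (sub _ fS) _ _ => //.
  by apply: contra sat; apply: accepted_satisfiable.
- by clear; rewrite !expnS expn0; nia.
Qed.

Theorem mainTheorem1 (R : realType) :
  ETH R ->
  exists2 c : R, 0 < c &
    ~ exists M : TM, poly_approx_max_mim M 3 (loglog_ratio c).
Proof.
move=> [delta delta0 eth]; exists 3%:R => // -[M [K [d hM]]].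
(* The first term makes the number of nodes, [#|{: kind}| * p ^ 3], at most [p ^ 4]; the second is
   the threshold of [loglog_ratio_small]. *)
pose pad := (#|{: kind}| + 2 ^ 11)%N.
have pad_ge : (2 ^ 11 <= pad)%N by apply: leq_addl.
have [M' [K' [d' hM']]] := preprocess (false, cR) offset_Zero offset_End
  M (pad := pad.+1) wf_generator isT.
(* With [p = q.+1], the bound [K' * p ^ d'] covers the length of the instance and all the work
   outside [M]; running [M] on an input of that length adds [K * (K' * p ^ d') ^ d]. *)
pose K2 := (K' + K * K' ^ d)%N; pose d2 := (d' + d' * d)%N.
apply: (eth M' (K2 * pad.+2 ^ d2)%N d2) => n phi.
set w := enc_cnf3 phi.
pose q := (size w + pad)%N.
have wq : (size w <= q)%N by apply: leq_addr.
have padq : (pad <= q)%N by apply: leq_addl.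
have q0 := q_gt0 wq.
have eq1 : (size w + pad.+1 = q.+1)%N by rewrite addnS.
set w' := aout w q.+1 generator (fun _ => 0%N).
have [t [S [ht hout fS hratio]]] := hM (inst w q) w' (encodes_generator w q0).
have [y ey] := enc_set_remember S.
have := hM' w t (remember S) y; rewrite eq1 -/w' => -[hsize hrun].
have [|t' ht' ho] := hrun; first by move: hout; rewrite ey.
have n3 : (3 <= #|cnode q|)%N.
  rewrite card_cnode; apply: leq_trans (leq_pmull _ card_kind).
  by move: q0; clear; case: q => // k _; rewrite !expnS expn0; nia.
exists t'; last first.
  rewrite -(remember_satisfiable (R := R) wq _ _ fS) //.
  - by apply: leq_trans padq; apply: leq_addr.
  - exact: leq_trans padq.
  - exact: hratio.
(* The exponential factor is used only through being at least [1]: the bound obtained is polynomial,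
   so it contradicts ETH for any [delta]. *)
have hpow : 1 <= 2 `^ (delta * n%:R) :> R.
  rewrite -[leLHS](powRr0 2); apply: ler_powR; first by rewrite ler1n.
  by apply: mulr_ge0 => //; apply: ltW.
apply: le_trans (_ : ((K2 * pad.+2 ^ d2) * size w ^ d2)%:R <= _); last first.
  rewrite natrM natrX; apply: ler_wpM2r; first by rewrite exprn_ge0 ?ler0n.
  by rewrite ler_peMr ?ler0n.
rewrite ler_nat -mulnA -expnMn; apply: leq_trans ht' _.
have w0 : (0 < size w)%N := leq_ltn_trans (leq0n _) (enc_cnf3_vars phi).
apply: leq_trans (_ : K2 * q.+1 ^ d2 <= _)%N; last first.
  rewrite leq_mul2l; apply/orP; right.
  (* Since [size w] is positive, the padding is absorbed by a constant factor, and powers of [p]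
     become powers of [size w]. *)
  have hb : (q.+1 <= pad.+2 * size w)%N by rewrite /q; move: w0; clear; nia.
  by move: hb; clear; elim: d2 => // k IH h; rewrite !expnS leq_mul ?IH.
have p0 : (0 < q.+1)%N by [].
rewrite /K2 /d2 mulnDl; apply: leq_add.
  by rewrite expnD leq_mul2l leq_pmulr ?orbT // expn_gt0.
apply: leq_trans ht _; rewrite -mulnA leq_mul2l; apply/orP; right.
apply: leq_trans (_ : (K' * q.+1 ^ d') ^ d <= _)%N.
  by move: hsize; clear; elim: d => // k IH h; rewrite !expnS leq_mul ?IH.
rewrite expnMn -expnM leq_mul2l expnD leq_pmull ?orbT //.
by rewrite expn_gt0.
Qed.
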